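(* Let $g_2,g_3\in\mathbb{R}$ with $g_2^3-27g_3^2\neq0$, let $\wp,\zeta,\sigma$ be the associated Weierstrass functions with period lattice $\Gamma$, let $\omega_1>0$ be the half period on the real axis (so $2\omega_1$ generates $\Gamma\cap\mathbb{R}$) and $\eta_1=\zeta(\omega_1)$. Let $E=\wp(\rho)\in\mathbb{R}$ not be a branch value of $\wp$, let $x_0\in\mathbb{C}$, and let $\gamma_E=[\hat\gamma_E^1,\hat\gamma^2_E]:\mathbb{R}\to\mathbb{CP}^1$ with $$\hat\gamma_E^1(x)=\frac{\sigma(x+x_0-\rho)}{\sigma(x+x_0)}e^{\zeta(\rho)(x+x_0)},\qquad \hat\gamma_E^2(x)=\frac{\sigma(x+x_0+\rho)}{\sigma(x+x_0)}e^{-\zeta(\rho)(x+x_0)}.$$ Then $\gamma_E$ closes after $n$ periods of $\wp$ ($n\ge1$) if and only if there exists $m\in\mathbb{Z}$ with $\gcd(m,n)=1$ such that $$2\eta_1\rho-2\zeta(\rho)\omega_1=\frac{m}{n}\pi i.$$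
   Context: Weierstrass functions: $\wp'^2=4\wp^3-g_2\wp-g_3$, $\zeta'=-\wp$ with $\zeta(z)-1/z\to0$ as $z\to0$, $\sigma'/\sigma=\zeta$ with $\sigma(z)/z\to1$ as $z\to0$. ''$\gamma_E$ closes after $n$ periods of $\wp$'' means that $n$ is the smallest positive integer with $\gamma_E(x+2n\omega_1)=\gamma_E(x)$ for all $x\in\mathbb{R}$. A branch value of $\wp$ is a root of $4x^3-g_2x-g_3$. *)

(* Defs.v *)
From Stdlib Require Import Reals ZArith.
From Coquelicot Require Import Coquelicot.

Open Scope C_scope.

Definition Cexp (z : C) : C :=
  ((exp (Re z) * cos (Im z))%R, (exp (Re z) * sin (Im z))%R).

(* [Im (w1 * Cconj w2) <> 0] says that w1 and w2 are linearly independent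
   over the reals. *)
Definition is_lattice (Gamma : C -> Prop) : Prop :=
  exists w1 w2 : C,
    Im (w1 * Cconj w2) <> 0%R /\
    forall z : C,
      Gamma z <-> exists m n : Z, z = RtoC (IZR m) * w1 + RtoC (IZR n) * w2.

(* Meromorphic functions are represented by total functions C -> C; their
   values at the poles, i.e. on Gamma, are irrelevant and unconstrained. *)

(* wp is the solution of the differential equation that has a pole at 0, and
   Gamma, the set of its periods, is also the set of its poles.
   The equation alone would leave the translation of wp free; the pole at 0
   fixes it. *)
Record is_wp (g2 g3 : R) (Gamma : C -> Prop) (wp : C -> C) : Prop := {
  wp_lattice : is_lattice Gamma;
  wp_periods : forall w : C,
    Gamma w <->
    forall z : C, ~ Gamma z -> ~ Gamma (z + w) -> wp (z + w) = wp z;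
  wp_pole : filterlim (fun z : C => Cmod (wp z))
              (locally' (RtoC 0)) (Rbar_locally p_infty);
  wp_ode : forall z : C, ~ Gamma z ->
    exists d : C,
      is_derive wp z d /\
      d ^ 2 = 4 * wp z ^ 3 - RtoC g2 * wp z - RtoC g3
}.

Record is_zeta (Gamma : C -> Prop) (wp zeta : C -> C) : Prop := {
  zeta_derive : forall z : C, ~ Gamma z -> is_derive zeta z (- wp z);
  zeta_at_0 : filterlim (fun z : C => zeta z - 1 / z)
                (locally' (RtoC 0)) (locally (RtoC 0))
}.

(* sigma is entire, and sigma' / sigma = zeta away from the poles of zeta. *)
Record is_sigma (Gamma : C -> Prop) (zeta sigma : C -> C) : Prop := {
  sigma_entire : forall z : C, ex_derive sigma z;
  sigma_logderive : forall z : C, ~ Gamma z ->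
    exists d : C,
      is_derive sigma z d /\ sigma z <> 0 /\ d / sigma z = zeta z;
  sigma_at_0 : filterlim (fun z : C => sigma z / z)
                 (locally' (RtoC 0)) (locally (RtoC 1))
}.

Definition branch_value (g2 g3 : R) (e : C) : Prop :=
  4 * e ^ 3 - RtoC g2 * e - RtoC g3 = 0.

Definition spanned_by (v w : C * C) : Prop :=
  exists c : C, w = (c * fst v, c * snd v).

(* Points of the complex projective line are the lines through 0 in C^2, as
   sets of vectors; propositional extensionality makes Leibniz equality of
   [CP1] the equality of lines. *)
Record CP1 : Type := mkCP1 {
  line : C * C -> Prop;
  line_spec : exists v : C * C,
    v <> (RtoC 0, RtoC 0) /\ forall w : C * C, line w <-> spanned_by v w
}.

Definition proj (v : C * C) (hv : v <> (RtoC 0, RtoC 0)) : CP1 :=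
  mkCP1 (spanned_by v)
    (ex_intro _ v (conj hv (fun w => iff_refl (spanned_by v w)))).

(* The quotient topology coming from C^2 \ {0}. *)
Definition open_CP1 (U : CP1 -> Prop) : Prop :=
  open (fun v : C * C =>
    exists hv : v <> (RtoC 0, RtoC 0), U (proj v hv)).

Definition continuous_CP1 (gamma : R -> CP1) : Prop :=
  forall U : CP1 -> Prop, open_CP1 U -> open (fun x : R => U (gamma x)).

Definition ghat1 (zeta sigma : C -> C) (rho x0 : C) (x : R) : C :=
  sigma (RtoC x + x0 - rho) / sigma (RtoC x + x0)
  * Cexp (zeta rho * (RtoC x + x0)).

Definition ghat2 (zeta sigma : C -> C) (rho x0 : C) (x : R) : C :=
  sigma (RtoC x + x0 + rho) / sigma (RtoC x + x0)
  * Cexp (- zeta rho * (RtoC x + x0)).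

(* The line x0 + R may meet Gamma.  There both homogeneous coordinates have a
   pole coming from their common denominator, and the value of the curve in
   the projective line is the one given by continuity. *)
Definition is_gamma_E (Gamma : C -> Prop) (zeta sigma : C -> C) (rho x0 : C)
    (gamma : R -> CP1) : Prop :=
  continuous_CP1 gamma /\
  forall x : R, ~ Gamma (RtoC x + x0) ->
    exists hv : (ghat1 zeta sigma rho x0 x, ghat2 zeta sigma rho x0 x)
                <> (RtoC 0, RtoC 0),
      gamma x = proj _ hv.

Definition has_period (gamma : R -> CP1) (t : R) : Prop :=
  forall x : R, gamma (x + t)%R = gamma x.

Definition closes_after (gamma : R -> CP1) (omega1 : R) (n : nat) : Prop :=
  (1 <= n)%nat /\
  has_period gamma (2 * INR n * omega1)%R /\
  forall k : nat, (1 <= k)%nat ->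
    has_period gamma (2 * INR k * omega1)%R -> (n <= k)%nat.

(* Main.v *)
Require Import Defs.
From Stdlib Require Import Reals ZArith Lra Lia Psatz.
From Stdlib Require Import Classical ClassicalEpsilon.
From Stdlib Require Import FunctionalExtensionality PropExtensionality ProofIrrelevance.
From Coquelicot Require Import Coquelicot.

Open Scope C_scope.

(** Over a period 2 k omega1 the two homogeneous coordinates of the curve are
    multiplied by exp (- k a) and exp (k a), where
    a = 2 eta1 rho - 2 zeta(rho) omega1; hence 2 k omega1 is a period of the
    curve if and only if k a lies in pi i Z, and the smallest such k is the
    denominator of a / (pi i).  The multipliers come from
    sigma (z + w) = c exp (eta z) sigma z with eta = zeta (z + w) - zeta z, and
    eta = 2 eta1 for w = 2 omega1 because zeta is odd.  Oddness is obtained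
    without the differential equation of wp: zeta z + zeta (- z) is periodic,
    tends to 0 at the lattice points and is holomorphic elsewhere, so it vanishes
    by Liouville's theorem.  As the derivatives - wp z + wp (- z) are known to be
    differentiable again, Liouville follows from the maximum principle for
    harmonic functions, with no complex integration. *)

(** * Complex derivatives *)

(** Two kinds of exceptional points shape the proof. The function zeta z + zeta (- z), extended by 0
    to [Gamma], is known to be continuous there but not differentiable. Instead of removing these
    singularities, the comparison behind Liouville's theorem is arranged to tolerate them: at such a
    point the function is 0, so the desired bound holds there at once and harmonicity is used only
    elsewhere. On the curve, the parameters x with x + x0 in [Gamma] carry a value fixed only by
    continuity. An identity between values of the curve is therefore checked on a dense set and
    extended, which requires that the projective line be Hausdorff.

    The lattice of the final condition is pi i Z and not 2 pi i Z because only the ratio of the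
    coordinates matters: it is multiplied by exp (- 2 k a), and both coordinates may change sign
    together. Reading this off one point of the curve requires both coordinates to be nonzero there,
    so a generic parameter must be found.

    Moduli are used throughout for distances in C; the filters [locally] and [locally'] at 0 in the
    definition of zeta unfold to squares and are translated once. *)

Definition ccont (f : C -> C) (z : C) : Prop :=
  forall e : R, (0 < e)%R -> exists d : R, (0 < d)%R /\
    forall y : C, (Cmod (y - z) < d)%R -> (Cmod (f y - f z) < e)%R.

(* Caratheodory's form of the complex derivative, which reduces the product and
   chain rules to the continuity of products and compositions. *)
Definition cder (f : C -> C) (z l : C) : Prop :=
  exists phi : C -> C,
    ccont phi z /\ phi z = l /\ forall y : C, f y = f z + phi y * (y - z).

Lemma ccont_const (c z : C) : ccont (fun _ => c) z.
Proof.
  intros e he; exists 1%R; split; [lra|]; intros y _.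
  replace (c - c) with (RtoC 0) by ring. now rewrite Cmod_0.
Qed.

Lemma ccont_id (z : C) : ccont (fun y => y) z.
Proof. intros e he; exists e; auto. Qed.

Lemma ccont_plus (f g : C -> C) (z : C) :
  ccont f z -> ccont g z -> ccont (fun y => f y + g y) z.
Proof.
  intros hf hg e he.
  destruct (hf (e / 2)%R) as (d1 & hd1 & h1); [lra|].
  destruct (hg (e / 2)%R) as (d2 & hd2 & h2); [lra|].
  exists (Rmin d1 d2); split; [now apply Rmin_glb_lt|]; intros y hy.
  specialize (h1 y (Rlt_le_trans _ _ _ hy (Rmin_l _ _))).
  specialize (h2 y (Rlt_le_trans _ _ _ hy (Rmin_r _ _))).
  replace (f y + g y - (f z + g z)) with ((f y - f z) + (g y - g z)) by ring.
  eapply Rle_lt_trans; [apply Cmod_triangle|]; lra.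
Qed.

Lemma ccont_mult (f g : C -> C) (z : C) :
  ccont f z -> ccont g z -> ccont (fun y => f y * g y) z.
Proof.
  intros hf hg e he.
  pose proof (Cmod_ge_0 (f z)) as Hf. pose proof (Cmod_ge_0 (g z)) as Hg.
  set (K := (Cmod (f z) + Cmod (g z) + 1)%R).
  assert (hK : (0 < K)%R) by (unfold K; lra).
  assert (hK' : (0 < e / (2 * K))%R) by (apply Rdiv_lt_0_compat; lra).
  destruct (hf (Rmin 1 (e / (2 * K)))) as (d1 & hd1 & h1).
  { apply Rmin_glb_lt; lra. }
  destruct (hg (e / (2 * K))%R) as (d2 & hd2 & h2); [lra|].
  exists (Rmin d1 d2); split; [now apply Rmin_glb_lt|]; intros y hy.
  specialize (h1 y (Rlt_le_trans _ _ _ hy (Rmin_l _ _))).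
  specialize (h2 y (Rlt_le_trans _ _ _ hy (Rmin_r _ _))).
  pose proof (Rlt_le_trans _ _ _ h1 (Rmin_l _ _)) as h3.
  pose proof (Rlt_le_trans _ _ _ h1 (Rmin_r _ _)) as h4.
  replace (f y * g y - f z * g z)
    with ((f y - f z) * (g y - g z) + f z * (g y - g z) + (f y - f z) * g z)
    by ring.
  eapply Rle_lt_trans; [apply Cmod_triangle|].
  eapply Rle_lt_trans; [apply Rplus_le_compat_r, Cmod_triangle|].
  rewrite !Cmod_mult.
  set (a := Cmod (f y - f z)) in *. set (b := Cmod (g y - g z)) in *.
  pose proof (Cmod_ge_0 (f y - f z)) as Ha. pose proof (Cmod_ge_0 (g y - g z)) as Hb.
  fold a in Ha; fold b in Hb.
  set (q := (e / (2 * K))%R) in *.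
  assert (hq : (e = 2 * K * q)%R) by (unfold q; field; lra).
  unfold K in hq. nra.
Qed.

Lemma ccont_comp (f g : C -> C) (z : C) :
  ccont f (g z) -> ccont g z -> ccont (fun y => f (g y)) z.
Proof.
  intros hf hg e he. destruct (hf e he) as (d & hd & h).
  destruct (hg d hd) as (d' & hd' & h'). exists d'; auto.
Qed.

Lemma ccont_inv (f : C -> C) (z : C) :
  ccont f z -> f z <> 0 -> ccont (fun y => / f y) z.
Proof.
  intros hf hz e he.
  pose proof (proj1 (Cmod_gt_0 _) hz) as hm. set (m := Cmod (f z)) in *.
  destruct (hf (Rmin (m / 2) (e * m * m / 2))) as (d & hd & h).
  { apply Rmin_glb_lt; [lra|]. assert (0 < e * m * m)%R by (repeat apply Rmult_lt_0_compat; lra). lra. }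
  exists d; split; [exact hd|]; intros y hy. specialize (h y hy).
  pose proof (Rlt_le_trans _ _ _ h (Rmin_l _ _)) as h1.
  pose proof (Rlt_le_trans _ _ _ h (Rmin_r _ _)) as h2.
  assert (hy2 : (m / 2 < Cmod (f y))%R).
  { pose proof (Cmod_triangle (f y) (f z - f y)) as ht.
    replace (f y + (f z - f y)) with (f z) in ht by ring.
    fold m in ht. replace (f z - f y) with (- (f y - f z)) in ht by ring.
    rewrite Cmod_opp in ht. lra. }
  assert (hy0 : f y <> 0) by (intros h0; rewrite h0, Cmod_0 in hy2; lra).
  replace (/ f y - / f z) with (- (f y - f z) * / (f y * f z)) by (field; auto).
  rewrite Cmod_mult, Cmod_opp, Cmod_inv, Cmod_mult.
  2: now apply Cmult_neq_0.
  fold m. apply (Rmult_lt_reg_r (Cmod (f y) * m)); [nra|].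
  assert (0 < e * m * (Cmod (f y) - m / 2))%R
    by (repeat apply Rmult_lt_0_compat; lra).
  rewrite Rmult_assoc, Rinv_l, Rmult_1_r; [lra|].
  apply Rmult_integral_contrapositive; lra.
Qed.

Lemma ccont_ext (f g : C -> C) (z : C) :
  (forall y, f y = g y) -> ccont f z -> ccont g z.
Proof.
  intros h hf e he; destruct (hf e he) as (d & hd & hy).
  exists d; split; [auto|]; intros y; rewrite <- !h; auto.
Qed.

Lemma cder_ccont (f : C -> C) (z l : C) : cder f z l -> ccont f z.
Proof.
  intros (phi & hphi & _ & h).
  apply (ccont_ext (fun y => f z + phi y * (y + - z))).
  { intros y; now rewrite (h y). }
  apply ccont_plus; [apply ccont_const|].
  apply ccont_mult; [exact hphi|].
  apply ccont_plus; [apply ccont_id | apply ccont_const].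
Qed.

Lemma cder_eps (f : C -> C) (z l : C) :
  (forall e : R, (0 < e)%R -> exists d : R, (0 < d)%R /\
     forall y : C, (Cmod (y - z) < d)%R ->
       (Cmod (f y - f z - l * (y - z)) <= e * Cmod (y - z))%R) ->
  cder f z l.
Proof.
  intros h.
  exists (fun y => if excluded_middle_informative (y = z) then l
                   else (f y - f z) / (y - z)).
  repeat split.
  - intros e he. destruct (h (e / 2)%R) as (d & hd & hy); [lra|].
    exists d; split; [exact hd|]; intros y hyd.
    destruct (excluded_middle_informative (z = z)) as [_|]; [|easy].
    destruct (excluded_middle_informative (y = z)) as [_|hne].
    { replace (l - l) with (RtoC 0) by ring; now rewrite Cmod_0. }
    assert (hyz : y - z <> 0).
    { intros h0; apply hne. replace y with ((y - z) + z) by ring. rewrite h0; ring. }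
    pose proof (proj1 (Cmod_gt_0 _) hyz) as hm.
    replace ((f y - f z) / (y - z) - l) with ((f y - f z - l * (y - z)) / (y - z))
      by (field; auto).
    rewrite Cmod_div by auto.
    apply (Rmult_lt_reg_r (Cmod (y - z))); [exact hm|].
    unfold Rdiv; rewrite Rmult_assoc, Rinv_l, Rmult_1_r by lra.
    specialize (hy y hyd). nra.
  - destruct (excluded_middle_informative (z = z)); easy.
  - intros y. destruct (excluded_middle_informative (y = z)) as [->|hne]; [ring|].
    field. intros h0; apply hne.
    replace y with ((y - z) + z) by ring. rewrite h0; ring.
Qed.

Lemma is_derive_cder (f : C -> C) (z l : C) : is_derive f z l -> cder f z l.
Proof.
  intros [_ h]. apply cder_eps. intros e he.
  destruct (h z (fun P H => H) (mkposreal e he)) as (d & hd).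
  exists d; split; [apply cond_pos|]; intros y hy.
  specialize (hd y hy).
  assert (E : f y - f z - l * (y - z)
     = minus (minus (f y) (f z)) (scal (minus y z) l)).
  { change (f y - f z - l * (y - z) = f y - f z - (y - z) * l); ring. }
  rewrite E. exact hd.
Qed.

Lemma cder_const (c z : C) : cder (fun _ => c) z 0.
Proof.
  exists (fun _ => RtoC 0); repeat split; [apply ccont_const|intros; ring].
Qed.

Lemma cder_id (z : C) : cder (fun y => y) z 1.
Proof.
  exists (fun _ => RtoC 1); repeat split; [apply ccont_const|intros; ring].
Qed.

Lemma cder_plus (f g : C -> C) (z a b : C) :
  cder f z a -> cder g z b -> cder (fun y => f y + g y) z (a + b).
Proof.
  intros (p & hp & <- & h1) (q & hq & <- & h2).
  exists (fun y => p y + q y); repeat split; [now apply ccont_plus|].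
  intros y; rewrite (h1 y), (h2 y); ring.
Qed.

Lemma cder_mult (f g : C -> C) (z a b : C) :
  cder f z a -> cder g z b -> cder (fun y => f y * g y) z (a * g z + f z * b).
Proof.
  intros hf hg. pose proof (cder_ccont _ _ _ hg) as hc.
  destruct hf as (p & hp & <- & h1); destruct hg as (q & hq & <- & h2).
  exists (fun y => p y * g y + f z * q y); repeat split.
  - apply ccont_plus; apply ccont_mult; auto using ccont_const.
  - intros y; rewrite (h1 y), (h2 y); ring.
Qed.

Lemma cder_comp (f g : C -> C) (z a b : C) :
  cder f (g z) a -> cder g z b -> cder (fun y => f (g y)) z (a * b).
Proof.
  intros hf hg. pose proof (cder_ccont _ _ _ hg) as hc.
  destruct hf as (p & hp & <- & h1); destruct hg as (q & hq & <- & h2).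
  exists (fun y => p (g y) * q y); repeat split.
  - apply ccont_mult; auto. now apply (ccont_comp p g).
  - intros y; rewrite (h1 (g y)), (h2 y); ring.
Qed.

Lemma cder_inv (a : C) : a <> 0 -> cder Cinv a (- / (a * a)).
Proof.
  intros ha. pose proof (proj1 (Cmod_gt_0 _) ha) as hm.
  assert (hc : ccont (fun y => - / (a * y)) a).
  { apply (ccont_ext (fun y => (- (1)) * / (a * y))); [intros; ring|].
    apply ccont_mult; [apply ccont_const|].
    apply ccont_inv; [|now apply Cmult_neq_0].
    apply ccont_mult; [apply ccont_const | apply ccont_id]. }
  (* The identity is required at every y, also at y = 0, where [/ 0] is 0: solving 0 = / a + phi 0 *
     (0 - a) gives / (a * a). Radii at most |a| keep this value out of the continuity argument at
     [a]. *)
  exists (fun y : C => if excluded_middle_informative (y = 0) then / (a * a)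
                   else - / (a * y)).
  repeat split.
  - intros e he. destruct (hc e he) as (d & hd & h).
    exists (Rmin d (Cmod a)); split; [now apply Rmin_glb_lt|]. intros y hy.
    destruct (excluded_middle_informative (a = 0)) as [|_]; [easy|].
    destruct (excluded_middle_informative (y = 0)) as [->|_].
    + pose proof (Rlt_le_trans _ _ _ hy (Rmin_r _ _)) as h1.
      replace (0 - a) with (- a) in h1 by ring. rewrite Cmod_opp in h1. lra.
    + apply h. eapply Rlt_le_trans; [exact hy | apply Rmin_l].
  - destruct (excluded_middle_informative (a = 0)); easy.
  - intros y. destruct (excluded_middle_informative (y = 0)) as [->|hy].
    + replace (/ 0) with (RtoC 0).
      2: { apply injective_projections; simpl; unfold Rdiv; ring. }
      field; auto.
    + field; auto.
Qed.

Lemma Cmod_le_Rabs (z : C) : (Cmod z <= Rabs (Re z) + Rabs (Im z))%R.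
Proof.
  replace z with (RtoC (Re z) + RtoC (Im z) * Ci) at 1.
  - eapply Rle_trans; [apply Cmod_triangle|].
    rewrite Cmod_mult, Cmod_Ci, !Cmod_R; lra.
  - apply injective_projections; unfold Re, Im; simpl; ring.
Qed.

Lemma im_le_Cmod (z : C) : (Rabs (Im z) <= Cmod z)%R.
Proof. eapply Rle_trans; [apply Rmax_r | apply Rmax_Cmod]. Qed.

Lemma derivable_pt_lim_eps (f : R -> R) (x l : R) :
  derivable_pt_lim f x l ->
  forall e : R, (0 < e)%R -> exists d : R, (0 < d)%R /\
    forall h : R, (Rabs h < d)%R ->
      (Rabs (f (x + h) - f x - l * h) <= e * Rabs h)%R.
Proof.
  intros hf e he. destruct (hf e he) as (d & hd). exists d.
  split; [apply cond_pos|]. intros h hh.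
  destruct (Req_dec h 0) as [->|h0].
  { rewrite Rplus_0_r, Rabs_R0.
    replace (f x - f x - l * 0)%R with 0%R by ring. rewrite Rabs_R0; lra. }
  specialize (hd h h0 hh).
  replace (f (x + h) - f x - l * h)%R with (((f (x + h) - f x) / h - l) * h)%R
    by (field; auto).
  rewrite Rabs_mult. apply Rmult_le_compat_r; [apply Rabs_pos | lra].
Qed.

(** * The complex exponential and its derivative *)

Lemma Cexp_plus (z w : C) : Cexp (z + w) = Cexp z * Cexp w.
Proof.
  unfold Cexp. replace (Re (z + w)) with (Re z + Re w)%R by reflexivity.
  replace (Im (z + w)) with (Im z + Im w)%R by reflexivity.
  rewrite exp_plus, cos_plus, sin_plus.
  apply injective_projections; simpl; ring.
Qed.

Lemma Cexp_0 : Cexp 0 = 1.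
Proof.
  unfold Cexp; simpl. rewrite exp_0, cos_0, sin_0.
  apply injective_projections; simpl; ring.
Qed.

Lemma Cexp_opp (z : C) : Cexp z * Cexp (- z) = 1.
Proof. rewrite <- Cexp_plus, <- Cexp_0. f_equal; ring. Qed.

Lemma Cexp_neq_0 (z : C) : Cexp z <> 0.
Proof.
  intros h. pose proof (Cexp_opp z) as h'. rewrite h, Cmult_0_l in h'.
  apply C1_nz; auto.
Qed.

Lemma cder_Cexp_0 : cder Cexp 0 1.
Proof.
  apply cder_eps. intros e he.
  (* The real and imaginary errors will be at most 4 q |y| and 5 q |y|, whence the 9. The bound q <=
     1 yields exp a <= 3. *)
  set (q := Rmin 1 (e / 9)).
  assert (hq : (0 < q)%R) by (apply Rmin_glb_lt; lra).
  assert (hq1 : (q <= 1)%R) by apply Rmin_l.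
  assert (hq9 : (9 * q <= e)%R) by (pose proof (Rmin_r 1 (e / 9)); fold q in H; lra).
  clearbody q.
  destruct (derivable_pt_lim_eps _ _ _ derivable_pt_lim_exp_0 q hq) as (d1 & hd1 & h1).
  destruct (derivable_pt_lim_eps _ _ _ derivable_pt_lim_sin_0 q hq) as (d2 & hd2 & h2).
  destruct (derivable_pt_lim_eps _ _ _ derivable_pt_lim_cos_0 q hq) as (d3 & hd3 & h3).
  exists (Rmin (Rmin d1 q) (Rmin d2 d3)).
  split; [repeat apply Rmin_glb_lt; auto|]. intros y.
  replace (y - 0) with y by ring. intros hy.
  assert (hy1 : (Cmod y < d1 /\ Cmod y < q /\ Cmod y < d2 /\ Cmod y < d3)%R).
  { pose proof (Rmin_l (Rmin d1 q) (Rmin d2 d3)).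
    pose proof (Rmin_r (Rmin d1 q) (Rmin d2 d3)).
    pose proof (Rmin_l d1 q). pose proof (Rmin_r d1 q).
    pose proof (Rmin_l d2 d3). pose proof (Rmin_r d2 d3). lra. }
  destruct hy1 as (hy1 & hyq & hy2 & hy3).
  pose proof (re_le_Cmod y) as ha. pose proof (im_le_Cmod y) as hb.
  rewrite Cexp_0. eapply Rle_trans; [apply Cmod_le_Rabs|].
  destruct y as [a b]. unfold Re, Im in *; simpl in *.
  unfold Re, Im; simpl. set (m := Cmod (a, b)) in *.
  specialize (h1 a ltac:(lra)). specialize (h2 b ltac:(lra)).
  specialize (h3 b ltac:(lra)).
  rewrite Rplus_0_l, exp_0 in h1. rewrite Rplus_0_l, sin_0 in h2.
  rewrite Rplus_0_l, cos_0 in h3.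
  replace (cos b - 1 - 0 * b)%R with (cos b - 1)%R in h3 by ring.
  replace (sin b - 0 - 1 * b)%R with (sin b - b)%R in h2 by ring.
  rewrite Rmult_1_l in h1.
  pose proof (Rabs_pos a) as pa. pose proof (Rabs_pos b) as pb.
  assert (hqa : (q * Rabs a <= q * 1)%R) by (apply Rmult_le_compat_l; lra).
  assert (hE : (0 < exp a <= 3)%R).
  { split; [apply exp_pos|]. apply Rabs_le_between in h1.
    pose proof (Rle_abs a). lra. }
  assert (hE1 : (Rabs (exp a - 1) <= 2 * q)%R).
  { replace (exp a - 1)%R with ((exp a - 1 - a) + a)%R by ring.
    eapply Rle_trans; [apply Rabs_triang|]. lra. }
  replace (exp a * cos b + - (1) + - (1 * a - 0 * b))%R
    with ((exp a - 1 - a) + exp a * (cos b - 1))%R by ring.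
  replace (exp a * sin b + - 0 + - (1 * b + 0 * a))%R
    with (exp a * (sin b - b) + (exp a - 1) * b)%R by ring.
  assert (hA : (Rabs (exp a - 1 - a + exp a * (cos b - 1)) <= 4 * q * m)%R).
  { eapply Rle_trans; [apply Rabs_triang|]. rewrite Rabs_mult, (Rabs_pos_eq (exp a)) by lra.
    pose proof (Rabs_pos (cos b - 1)).
    assert (exp a * Rabs (cos b - 1) <= 3 * (q * Rabs b))%R by (apply Rmult_le_compat; lra).
    nra. }
  assert (hB : (Rabs (exp a * (sin b - b) + (exp a - 1) * b) <= 5 * q * m)%R).
  { eapply Rle_trans; [apply Rabs_triang|]. rewrite !Rabs_mult, (Rabs_pos_eq (exp a)) by lra.
    pose proof (Rabs_pos (sin b - b)). pose proof (Rabs_pos (exp a - 1)).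
    assert (exp a * Rabs (sin b - b) <= 3 * (q * Rabs b))%R by (apply Rmult_le_compat; lra).
    assert (Rabs (exp a - 1) * Rabs b <= 2 * q * Rabs b)%R by (apply Rmult_le_compat; lra).
    nra. }
  nra.
Qed.

Lemma cder_ext (f g : C -> C) (z l : C) :
  (forall y, f y = g y) -> cder f z l -> cder g z l.
Proof.
  intros h (p & hp & hl & hf). exists p; repeat split; auto.
  intros y; rewrite <- !h; auto.
Qed.

Lemma cder_scal (c : C) (f : C -> C) (z a : C) :
  cder f z a -> cder (fun y => c * f y) z (c * a).
Proof.
  intros h. replace (c * a) with (0 * f z + c * a) by ring.
  apply (cder_mult (fun _ => c)); [apply cder_const | exact h].
Qed.

Lemma cder_shift (f : C -> C) (z w a : C) :
  cder f (z + w) a -> cder (fun y => f (y + w)) z a.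
Proof.
  intros h. replace a with (a * (1 + 0)) by ring.
  apply (cder_comp f (fun y => y + w)); [exact h|].
  apply cder_plus; [apply cder_id | apply cder_const].
Qed.

Lemma cder_reflect (f : C -> C) (z a : C) :
  cder f (- z) a -> cder (fun y => f (- y)) z (- a).
Proof.
  intros h. replace (- a) with (a * (- (1) * 1)) by ring.
  apply (cder_comp f (fun y => - y)); [exact h|].
  apply (cder_ext (fun y => - (1) * y)); [intros; ring|].
  apply cder_scal, cder_id.
Qed.

Lemma cder_Cexp_scal (c z : C) : cder (fun y => Cexp (c * y)) z (c * Cexp (c * z)).
Proof.
  apply (cder_ext (fun y => Cexp (c * z) * Cexp (c * (y - z)))).
  { intros y; rewrite <- Cexp_plus; f_equal; ring. }
  replace (c * Cexp (c * z)) with (Cexp (c * z) * (1 * (c * (1 + 0)))) by ring.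
  apply cder_scal. apply (cder_comp Cexp (fun y => c * (y - z))).
  - replace (c * (z - z)) with (RtoC 0) by ring. apply cder_Cexp_0.
  - apply cder_scal. unfold Cminus. apply cder_plus; [apply cder_id | apply cder_const].
Qed.

(** The bridge to real analysis: it reduces complex derivatives to real ones along lines, where the
    mean value theorem and the second derivative test are available. *)
Lemma cder_line_Re (f : C -> C) (z d l : C) (t : R) :
  cder f (z + RtoC t * d) l ->
  is_derive (fun s : R => Re (f (z + RtoC s * d))) t (Re (l * d)).
Proof.
  intros (p & hp & <- & hf). apply is_derive_Reals. intros e he.
  set (z0 := z + RtoC t * d) in *.
  pose proof (Cmod_ge_0 d) as hd.
  destruct (hp (e / (Cmod d + 1))%R) as (r & hr & h).
  { apply Rdiv_lt_0_compat; lra. }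
  assert (hr' : (0 < r / (Cmod d + 1))%R) by (apply Rdiv_lt_0_compat; lra).
  exists (mkposreal _ hr'). intros k hk0 hk. simpl in hk.
  set (y := z + RtoC (t + k) * d).
  assert (hyz : y - z0 = RtoC k * d) by (unfold y, z0; rewrite RtoC_plus; ring).
  assert (hy : (Cmod (y - z0) < r)%R).
  { rewrite hyz, Cmod_mult, Cmod_R.
    apply Rlt_div_r in hk; [|lra]. pose proof (Rabs_pos k). nra. }
  specialize (h y hy).
  replace (f y) with (f z0 + p y * (y - z0)) by (symmetry; apply hf).
  rewrite hyz.
  replace ((Re (f z0 + p y * (RtoC k * d)) - Re (f z0)) / k - Re (p z0 * d))%R
    with (Re ((p y - p z0) * d)).
  2: { unfold Re; simpl. field; auto. }
  eapply Rle_lt_trans; [apply re_le_Cmod|]. rewrite Cmod_mult.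
  apply Rlt_div_r in h; [|lra]. pose proof (Cmod_ge_0 (p y - p z0)). nra.
Qed.

Lemma cder_0_segment (f : C -> C) (z d : C) :
  (forall t : R, (0 <= t <= 1)%R -> cder f (z + RtoC t * d) 0) ->
  f (z + d) = f z.
Proof.
  assert (hre : forall g : C -> C,
    (forall t : R, (0 <= t <= 1)%R -> cder g (z + RtoC t * d) 0) ->
    Re (g (z + d)) = Re (g z)).
  { intros g hg.
    replace (z + d) with (z + RtoC 1 * d) by ring.
    replace z with (z + RtoC 0 * d) at 2 by ring.
    symmetry. apply (eq_is_derive (fun t : R => Re (g (z + RtoC t * d)))); [|lra].
    intros t ht. change zero with 0%R.
    replace 0%R with (Re (0 * d)) by (unfold Re; simpl; ring).
    apply cder_line_Re; auto. }
  intros h. apply injective_projections; [exact (hre f h)|].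
  (* The imaginary part of f is the real part of [- Ci * f], so the real case applies again. *)
  assert (h' : Re (- Ci * f (z + d)) = Re (- Ci * f z)).
  { apply (hre (fun y => - Ci * f y)). intros t ht.
    replace (RtoC 0) with (- Ci * 0) by ring. apply cder_scal; auto. }
  unfold Re in h'; simpl in h'. lra.
Qed.

(** * Lattices *)

Definition is_int (x : R) : Prop := exists m : Z, x = IZR m.

Lemma not_is_int_between (m : Z) (x : R) : (IZR m < x < IZR (m + 1))%R -> ~ is_int x.
Proof.
  intros [h1 h2] [k ->]. apply lt_IZR in h1. apply lt_IZR in h2. lia.
Qed.

Lemma not_is_int_half : ~ is_int (1 / 2).
Proof. apply (not_is_int_between 0); simpl; lra. Qed.

Lemma not_is_int_nbhd (x : R) : ~ is_int x ->
  exists e : R, (0 < e)%R /\ forall y : R, (Rabs (y - x) < e)%R -> ~ is_int y.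
Proof.
  intros hx. pose proof (archimed x) as [h1 h2].
  assert (h3 : (IZR (up x - 1) < x)%R).
  { rewrite minus_IZR. destruct (Rlt_or_le (IZR (up x) - 1) x) as [h|h]; [exact h|].
    exfalso; apply hx; exists (up x - 1)%Z. rewrite minus_IZR; lra. }
  exists (Rmin (IZR (up x) - x) (x - IZR (up x - 1))). split.
  - apply Rmin_glb_lt; lra.
  - intros y hy. apply (not_is_int_between (up x - 1)).
    replace (up x - 1 + 1)%Z with (up x) by ring.
    pose proof (Rlt_le_trans _ _ _ hy (Rmin_l _ _)) as h4.
    pose proof (Rlt_le_trans _ _ _ hy (Rmin_r _ _)) as h5.
    apply Rabs_lt_between in h4. apply Rabs_lt_between in h5. lra.
Qed.

(* The coefficient of [u] in the expansion of [z] in the real basis (u, v). *)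
Definition coord (u v z : C) : R := (Im (z * Cconj v) / Im (u * Cconj v))%R.

Lemma coord_line (u v z d : C) (r : R) :
  coord u v (z + RtoC r * d) = (coord u v z + r * coord u v d)%R.
Proof. unfold coord, Im, Rdiv; simpl; ring. Qed.

Lemma coord_self (u v : C) : Im (u * Cconj v) <> 0%R -> coord u v u = 1%R.
Proof. intros h; unfold coord; field; exact h. Qed.

Lemma coord_other (u v : C) : coord u v v = 0%R.
Proof. unfold coord, Im, Rdiv; simpl; ring. Qed.

Lemma coord_sym_neq_0 (u v : C) : Im (u * Cconj v) <> 0%R -> Im (v * Cconj u) <> 0%R.
Proof. unfold Im; simpl; intros h h'; apply h; lra. Qed.

Lemma coord_decomp (u v z : C) : Im (u * Cconj v) <> 0%R ->
  z = RtoC (coord u v z) * u + RtoC (coord v u z) * v.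
Proof.
  intros h. pose proof (coord_sym_neq_0 _ _ h) as h'.
  destruct u as [a b], v as [c d], z as [x y].
  unfold coord, Im in *; simpl in *.
  apply injective_projections; simpl; field; split; intros h0.
  all: first [apply h'; lra | apply h; lra].
Qed.

Lemma coord_bound (u v : C) : exists K : R, (0 < K)%R /\
  forall z d : C, (Rabs (coord u v z - coord u v d) <= K * Cmod (z - d))%R.
Proof.
  set (D := Rabs (/ Im (u * Cconj v))).
  assert (hD : (0 <= D)%R) by apply Rabs_pos.
  pose proof (Cmod_ge_0 v) as hv.
  (* The summand 1 keeps the Lipschitz constant positive, so that it can serve as a divisor. *)
  exists (D * Cmod v + 1)%R. split; [nra|]. intros z d.
  replace (coord u v z - coord u v d)%R
    with (Im ((z - d) * Cconj v) * / Im (u * Cconj v))%R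
    by (unfold coord, Im, Rdiv; simpl; ring).
  rewrite Rabs_mult. fold D.
  pose proof (im_le_Cmod ((z - d) * Cconj v)) as h.
  rewrite Cmod_mult, Cmod_conj in h.
  pose proof (Cmod_ge_0 (z - d)). nra.
Qed.

Section Lattice.

Variable Gamma : C -> Prop.
Hypothesis hG : is_lattice Gamma.

Lemma lattice_coord : exists u v : C, Im (u * Cconj v) <> 0%R /\
  forall z, Gamma z <-> is_int (coord u v z) /\ is_int (coord v u z).
Proof.
  destruct hG as (u & v & h & hz). exists u, v. split; [exact h|].
  pose proof (coord_sym_neq_0 _ _ h) as h'.
  intros z; rewrite hz; split.
  - intros (m & n & ->).
    replace (RtoC (IZR m) * u + RtoC (IZR n) * v)
      with (0 + RtoC (IZR m) * u + RtoC (IZR n) * v) by ring.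
    rewrite !coord_line, !coord_self, !coord_other by auto.
    unfold coord; rewrite Cmult_0_l. split; [exists m | exists n]; unfold Rdiv; simpl; ring.
  - intros ((m & hm) & (n & hn)). exists m, n.
    rewrite <- hm, <- hn. now apply coord_decomp.
Qed.

Lemma lattice_0 : Gamma 0.
Proof.
  destruct hG as (u & v & _ & h). apply h. exists 0%Z, 0%Z. ring.
Qed.

Lemma lattice_plus (z w : C) : Gamma z -> Gamma w -> Gamma (z + w).
Proof.
  destruct hG as (u & v & _ & h). rewrite !h.
  intros (m & n & ->) (m' & n' & ->). exists (m + m')%Z, (n + n')%Z.
  rewrite !plus_IZR, !RtoC_plus. ring.
Qed.

Lemma lattice_opp (z : C) : Gamma z -> Gamma (- z).
Proof.
  destruct hG as (u & v & _ & h). rewrite !h.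
  intros (m & n & ->). exists (- m)%Z, (- n)%Z.
  rewrite !opp_IZR, !RtoC_opp. ring.
Qed.

Lemma lattice_opp_iff (z : C) : Gamma (- z) <-> Gamma z.
Proof.
  split; [|apply lattice_opp]. intros h.
  replace z with (- - z) by ring. now apply lattice_opp.
Qed.

Lemma lattice_shift (z w : C) : Gamma w -> (Gamma (z + w) <-> Gamma z).
Proof.
  intros hw; split; intros h; [|now apply lattice_plus].
  replace z with (z + w + - w) by ring.
  apply lattice_plus; [exact h | now apply lattice_opp].
Qed.

Lemma lattice_closed (z : C) : ~ Gamma z ->
  exists d : R, (0 < d)%R /\ forall y : C, (Cmod (y - z) < d)%R -> ~ Gamma y.
Proof.
  destruct lattice_coord as (u & v & _ & h). rewrite h. intros hz.
  assert (hn : forall a b : C, ~ is_int (coord a b z) ->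
    exists d : R, (0 < d)%R /\
      forall y : C, (Cmod (y - z) < d)%R -> ~ is_int (coord a b y)).
  { intros a b hab. destruct (not_is_int_nbhd _ hab) as (e & he & hy).
    destruct (coord_bound a b) as (K & hK & hb).
    exists (e / K)%R; split; [now apply Rdiv_lt_0_compat|].
    intros y hyd; apply hy. eapply Rle_lt_trans; [apply hb|].
    apply Rlt_div_r in hyd; lra. }
  apply not_and_or in hz. destruct hz as [hz|hz];
    destruct (hn _ _ hz) as (d & hd & hy); exists d; split; auto;
    intros y hyd; rewrite h; intros [h1 h2]; eapply hy; eauto.
Qed.

(** Lattice points have integral coordinates, and two integers less than 1 apart coincide. The
    radius [/ (K + K')] makes both coordinate differences less than 1 at once. *)
Lemma lattice_discrete (z : C) : Gamma z ->
  exists d : R, (0 < d)%R /\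
    forall y : C, (Cmod (y - z) < d)%R -> y <> z -> ~ Gamma y.
Proof.
  intros hz. destruct lattice_coord as (u & v & huv & h).
  destruct (coord_bound u v) as (K & hK & hb).
  destruct (coord_bound v u) as (K' & hK' & hb').
  exists (/ (K + K'))%R. split; [apply Rinv_0_lt_compat; lra|].
  intros y hyd hne hy. apply hne.
  assert (hm : (Cmod (y - z) * (K + K') < 1)%R).
  { apply (Rmult_lt_compat_r (K + K')) in hyd; [|lra].
    rewrite Rinv_l in hyd; lra. }
  pose proof (Cmod_ge_0 (y - z)) as hm0.
  rewrite h in hy, hz. destruct hy as ((a & ha) & (b & hb0)).
  destruct hz as ((a' & ha') & (b' & hb0')).
  specialize (hb y z). specialize (hb' y z).
  rewrite ha, ha' in hb. rewrite hb0, hb0' in hb'.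
  assert (e0 : forall m n : Z, (Rabs (IZR m - IZR n) < 1)%R -> m = n).
  { intros m n hmn. rewrite <- minus_IZR in hmn. apply Rabs_lt_between in hmn.
    destruct hmn as [h1 h2].
    apply (lt_IZR (-1)) in h1. apply (lt_IZR _ 1) in h2. lia. }
  assert (a = a') by (apply e0; nra). assert (b = b') by (apply e0; nra). subst.
  rewrite (coord_decomp u v y huv), (coord_decomp u v z huv), ha, hb0, ha', hb0'.
  reflexivity.
Qed.

Lemma lattice_fundamental : exists B : R, (0 <= B)%R /\
  forall z : C, exists w : C, Gamma w /\ (Cmod (z - w) <= B)%R.
Proof.
  destruct hG as (u & v & huv & h).
  exists (Cmod u + Cmod v)%R.
  pose proof (Cmod_ge_0 u). pose proof (Cmod_ge_0 v). split; [lra|]. intros z.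
  set (a := coord u v z). set (b := coord v u z).
  (* [up] exceeds its argument by at most 1, so each coordinate contributes at most the length of
     its period to the distance. *)
  exists (RtoC (IZR (up a)) * u + RtoC (IZR (up b)) * v). split.
  { apply h. now exists (up a), (up b). }
  rewrite (coord_decomp u v z huv). fold a b.
  replace (RtoC a * u + RtoC b * v - (RtoC (IZR (up a)) * u + RtoC (IZR (up b)) * v))
    with (RtoC (a - IZR (up a)) * u + RtoC (b - IZR (up b)) * v)
    by (rewrite !RtoC_minus; ring).
  eapply Rle_trans; [apply Cmod_triangle|]. rewrite !Cmod_mult, !Cmod_R.
  assert (hup : forall r : R, (Rabs (r - IZR (up r)) <= 1)%R).
  { intros r. pose proof (archimed r). apply Rabs_le_between. lra. }
  pose proof (hup a). pose proof (hup b). nra.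
Qed.

(* A point outside the lattice has a non-integral coordinate; varying the other
   coordinate first, it is joined to the centre (u + v) / 2 inside the
   complement of the lattice. *)
Lemma lattice_cder_0 (f : C -> C) :
  (forall z : C, ~ Gamma z -> cder f z 0) ->
  forall z1 z2 : C, ~ Gamma z1 -> ~ Gamma z2 -> f z1 = f z2.
Proof.
  intros hf. destruct lattice_coord as (u & v & huv & h).
  pose proof (coord_sym_neq_0 _ _ huv) as hvu.
  assert (step : forall (z d : C),
    (~ is_int (coord u v z) /\ coord u v d = 0%R) \/
    (~ is_int (coord v u z) /\ coord v u d = 0%R) -> f (z + d) = f z).
  { intros z d hzd. apply cder_0_segment. intros t _. apply hf. rewrite h.
    rewrite !coord_line. intros [h1 h2].
    destruct hzd as [[h3 h4]|[h3 h4]]; rewrite h4, Rmult_0_r, Rplus_0_r in *; auto. }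
  assert (centre : forall z : C, ~ Gamma z ->
    f z = f (RtoC (1 / 2) * u + RtoC (1 / 2) * v)).
  { intros z hz. set (a := coord u v z). set (b := coord v u z).
    set (du := RtoC (1 / 2 - a) * u). set (dv := RtoC (1 / 2 - b) * v).
    assert (eu : coord u v du = (1 / 2 - a)%R /\ coord v u du = 0%R).
    { unfold du. rewrite <- (Cplus_0_l (RtoC _ * u)), !coord_line, coord_self, coord_other by auto.
      unfold coord; rewrite Cmult_0_l; split; unfold Rdiv; simpl; ring. }
    assert (ev : coord v u dv = (1 / 2 - b)%R /\ coord u v dv = 0%R).
    { unfold dv. rewrite <- (Cplus_0_l (RtoC _ * v)), !coord_line, coord_self, coord_other by auto.
      unfold coord; rewrite Cmult_0_l; split; unfold Rdiv; simpl; ring. }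
    assert (ec : RtoC (1 / 2) * u + RtoC (1 / 2) * v = z + du + dv).
    { rewrite (coord_decomp u v z huv). fold a b. unfold du, dv.
      rewrite !RtoC_minus. ring. }
    assert (addc : forall p q x y : C, coord p q (x + y) = (coord p q x + coord p q y)%R).
    { intros. rewrite <- (Cmult_1_l y) at 1. rewrite coord_line; ring. }
    rewrite ec. rewrite h in hz. apply not_and_or in hz. destruct hz as [hz|hz].
    - replace (z + du + dv) with (z + dv + du) by ring.
      rewrite (step (z + dv) du), (step z dv); auto; [left; tauto|].
      right. rewrite addc. split; [|tauto]. destruct ev as [-> _].
      fold b. replace (b + (1 / 2 - b))%R with (1 / 2)%R by ring. apply not_is_int_half.
    - rewrite (step (z + du) dv), (step z du); auto; [right; tauto|].
      left. rewrite addc. split; [|tauto]. destruct eu as [-> _].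
      fold a. replace (a + (1 / 2 - a))%R with (1 / 2)%R by ring. apply not_is_int_half. }
  intros z1 z2 h1 h2. rewrite (centre z1 h1), (centre z2 h2). reflexivity.
Qed.

End Lattice.

(** * The maximum principle *)

(** Compactness of a square containing the disc, for statements that become weaker as d shrinks. It
    serves for upper bounds, written [/ d], as well as for gaps below a supremum, written
    [M - d]. *)
Lemma disc_compact (B : R) (Q : R -> C -> Prop) :
  (forall (d d' : R) (y : C), (0 < d' <= d)%R -> Q d y -> Q d' y) ->
  (forall p : C, exists d : R, (0 < d)%R /\
     forall y : C, (Cmod (y - p) < d)%R -> Q d y) ->
  exists d : R, (0 < d)%R /\ forall y : C, (Cmod y <= B)%R -> Q d y.
Proof.
  intros hanti hloc.
  set (del := fun p : C => proj1_sig (constructive_indefinite_description _ (hloc p))).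
  assert (hdel : forall p, (0 < del p)%R /\
    forall y : C, (Cmod (y - p) < del p)%R -> Q (del p) y).
  { intros p; exact (proj2_sig (constructive_indefinite_description _ (hloc p))). }
  assert (hdel2 : forall p, (0 < del p / 2)%R) by (intros p; destruct (hdel p); lra).
  (* The radius is halved because the cover consists of squares: two coordinate differences below
     [del p / 2] give a modulus below [del p]. *)
  destruct (compactness_value_2d (- B) B (- B) B
    (fun a b => mkposreal _ (hdel2 (a, b)))) as (d & hd).
  exists d; split; [apply cond_pos|]. intros y hy.
  pose proof (re_le_Cmod y) as hre. pose proof (im_le_Cmod y) as him.
  specialize (hd (Re y) (Im y)). simpl in hd.
  destruct (NNPP _ (hd ltac:(apply Rabs_le_between; lra)
                       ltac:(apply Rabs_le_between; lra)))
    as (a & b & _ & _ & h1 & h2 & h3).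
  destruct (hdel (a, b)) as [h4 h5].
  apply (hanti (del (a, b))).
  { pose proof (cond_pos d). lra. }
  apply h5. eapply Rle_lt_trans; [apply Cmod_le_Rabs|].
  unfold Re, Im in *; simpl. unfold Rminus in *. lra.
Qed.

Definition rcont (f : C -> R) (z : C) : Prop :=
  forall e : R, (0 < e)%R -> exists d : R, (0 < d)%R /\
    forall y : C, (Cmod (y - z) < d)%R -> (Rabs (f y - f z) < e)%R.

(** Compactness is used twice: local bounds give a supremum M, and if M were not attained, local
    gaps below M would give a uniform gap, contradicting the choice of M. Near a point outside A
    both conditions are vacuous, as A is closed. *)
Lemma max_attained (f : C -> R) (A : C -> Prop) (B : R) :
  (forall y, A y -> (Cmod y <= B)%R) ->
  (forall p, ~ A p -> exists d : R, (0 < d)%R /\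
     forall y : C, (Cmod (y - p) < d)%R -> ~ A y) ->
  (forall p, A p -> rcont f p) ->
  (exists p, A p) ->
  exists p, A p /\ forall y, A y -> (f y <= f p)%R.
Proof.
  intros hB hcl hf [z0 hz0].
  destruct (disc_compact B (fun d y => A y -> (f y <= / d)%R)) as (d & hd & hb).
  { intros d d' y [h1 h2] h hy. eapply Rle_trans; [now apply h|].
    now apply Rinv_le_contravar. }
  { intros p. destruct (classic (A p)) as [hp|hp].
    - destruct (hf p hp 1%R ltac:(lra)) as (d & hd & h).
      pose proof (Rabs_pos (f p)) as hp0.
      assert (hi : (0 < / (Rabs (f p) + 1))%R) by (apply Rinv_0_lt_compat; lra).
      exists (Rmin d (/ (Rabs (f p) + 1))). split; [now apply Rmin_glb_lt|].
      intros y hy _. specialize (h y (Rlt_le_trans _ _ _ hy (Rmin_l _ _))).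
      apply Rabs_lt_between in h. pose proof (Rle_abs (f p)).
      apply Rle_trans with (Rabs (f p) + 1)%R; [lra|].
      rewrite <- (Rinv_inv (Rabs (f p) + 1)) at 1.
      apply Rinv_le_contravar; [now apply Rmin_glb_lt | apply Rmin_r].
    - destruct (hcl p hp) as (d & hd & h). exists d; split; [exact hd|].
      intros y hy hA. exfalso; exact (h y hy hA). }
  destruct (completeness (fun r => exists y, A y /\ r = f y)) as (M & hM1 & hM2).
  { exists (/ d)%R. intros r (y & hy & ->). auto. }
  { exists (f z0), z0. auto. }
  apply NNPP. intros hno.
  assert (hlt : forall p, A p -> (f p < M)%R).
  { intros p hp. destruct (Rle_lt_or_eq_dec (f p) M) as [h|h]; [apply hM1; eauto|exact h|].
    exfalso; apply hno. exists p; split; [exact hp|]. intros y hy. rewrite h.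
    apply hM1; eauto. }
  destruct (disc_compact B (fun d y => A y -> (f y <= M - d)%R)) as (d' & hd' & hb').
  { intros e e' y [h1 h2] h hy. specialize (h hy). lra. }
  { intros p. destruct (classic (A p)) as [hp|hp].
    - pose proof (hlt p hp) as hpM.
      destruct (hf p hp ((M - f p) / 2)%R ltac:(lra)) as (e & he & h).
      exists (Rmin e ((M - f p) / 2)). split; [apply Rmin_glb_lt; lra|].
      intros y hy _. specialize (h y (Rlt_le_trans _ _ _ hy (Rmin_l _ _))).
      pose proof (Rmin_r e ((M - f p) / 2)).
      apply Rabs_lt_between in h. lra.
    - destruct (hcl p hp) as (e & he & h). exists e; split; [exact he|].
      intros y hy hA. exfalso; exact (h y hy hA). }
  assert (M <= M - d')%R; [|lra].
  apply hM2. intros r (y & hy & ->). auto.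
Qed.

(** * Second derivatives and Laplacians at a point *)

Definition second_der (phi : R -> R) (s : R) : Prop :=
  exists phi' : R -> R,
    (exists e : R, (0 < e)%R /\
       forall t : R, (Rabs t < e)%R -> is_derive phi t (phi' t)) /\
    is_derive phi' 0%R s.

(** At a maximum phi' vanishes; if s were positive, phi' would be positive just to the right of 0,
    and the mean value theorem would make phi exceed its maximum. *)
Lemma second_der_max (phi : R -> R) (s : R) :
  second_der phi s ->
  (exists e : R, (0 < e)%R /\ forall t : R, (Rabs t < e)%R -> (phi t <= phi 0%R)%R) ->
  (s <= 0)%R.
Proof.
  intros (phi' & (e & he & hd) & hs) (e' & he' & hmax).
  destruct (Rle_or_lt s 0) as [h|hpos]; [exact h|exfalso].
  assert (h0 : phi' 0%R = 0%R).
  { assert (h1 : derivable_pt_lim phi 0 (phi' 0%R)).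
    { apply is_derive_Reals, hd. rewrite Rabs_R0; lra. }
    pose (pr := exist _ _ h1 : derivable_pt phi 0).
    change (phi' 0%R) with (derive_pt phi 0 pr).
    apply (deriv_maximum phi (- e') e' 0); try lra.
    intros x h2 h3. apply hmax. apply Rabs_lt_between; lra. }
  apply is_derive_Reals in hs.
  destruct (derivable_pt_lim_eps _ _ _ hs (s / 2)%R ltac:(lra)) as (r & hr & h).
  set (t := (Rmin r (Rmin e e') / 2)%R).
  assert (ht : (0 < t < r /\ t < e /\ t < e')%R).
  { assert (0 < Rmin r (Rmin e e'))%R by (repeat apply Rmin_glb_lt; auto).
    pose proof (Rmin_l r (Rmin e e')). pose proof (Rmin_r r (Rmin e e')).
    pose proof (Rmin_l e e'). pose proof (Rmin_r e e'). unfold t; lra. }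
  destruct (MVT_cor2 phi phi' 0 t) as (c & hc & hc1); [lra| |].
  { intros x hx. apply is_derive_Reals, hd. rewrite Rabs_pos_eq; lra. }
  specialize (hmax t). rewrite Rabs_pos_eq in hmax by lra.
  specialize (hmax ltac:(lra)).
  specialize (h c). rewrite Rplus_0_l, h0, Rabs_pos_eq in h by lra.
  specialize (h ltac:(lra)). apply Rabs_le_between in h.
  assert (0 < s * c)%R by (apply Rmult_lt_0_compat; lra).
  assert (0 < phi' c * (t - 0))%R by (apply Rmult_lt_0_compat; lra). lra.
Qed.

Lemma second_der_plus (phi psi : R -> R) (a b : R) :
  second_der phi a -> second_der psi b ->
  second_der (fun t => phi t + psi t)%R (a + b)%R.
Proof.
  intros (f & (e & he & h) & hf) (g & (e' & he' & h') & hg).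
  exists (fun t => f t + g t)%R. split.
  - exists (Rmin e e'). split; [now apply Rmin_glb_lt|]. intros t ht.
    refine (is_derive_plus phi psi t _ _ _ _).
    + apply h. eapply Rlt_le_trans; [exact ht | apply Rmin_l].
    + apply h'. eapply Rlt_le_trans; [exact ht | apply Rmin_r].
  - exact (is_derive_plus f g 0%R _ _ hf hg).
Qed.

Lemma second_der_scal (k : R) (phi : R -> R) (a : R) :
  second_der phi a -> second_der (fun t => k * phi t)%R (k * a)%R.
Proof.
  intros (f & (e & he & h) & hf). exists (fun t => k * f t)%R. split.
  - exists e. split; [exact he|]. intros t ht. apply is_derive_scal. auto.
  - apply is_derive_scal. exact hf.
Qed.

(** A relation at a single point, since only the second derivative test is applied to it. The factor
    [1] gives both directions the common shape [z + RtoC t * d]. *)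
Definition laplacian (f : C -> R) (z : C) (s : R) : Prop :=
  exists a b : R,
    second_der (fun t => f (z + RtoC t * 1)) a /\
    second_der (fun t => f (z + RtoC t * Ci)) b /\ s = (a + b)%R.

Lemma laplacian_plus (f g : C -> R) (z : C) (s s' : R) :
  laplacian f z s -> laplacian g z s' ->
  laplacian (fun y => f y + g y)%R z (s + s')%R.
Proof.
  intros (a & b & ha & hb & ->) (c & d & hc & hd & ->).
  exists (a + c)%R, (b + d)%R. repeat split; [| |ring];
    [exact (second_der_plus _ _ _ _ ha hc) | exact (second_der_plus _ _ _ _ hb hd)].
Qed.

Lemma laplacian_scal (k : R) (f : C -> R) (z : C) (s : R) :
  laplacian f z s -> laplacian (fun y => k * f y)%R z (k * s)%R.
Proof.
  intros (a & b & ha & hb & ->).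
  exists (k * a)%R, (k * b)%R. repeat split; [| |ring];
    [exact (second_der_scal k _ _ ha) | exact (second_der_scal k _ _ hb)].
Qed.

Lemma laplacian_max (f : C -> R) (z : C) (s : R) :
  laplacian f z s ->
  (exists e : R, (0 < e)%R /\
     forall y : C, (Cmod (y - z) < e)%R -> (f y <= f z)%R) ->
  (s <= 0)%R.
Proof.
  intros (a & b & ha & hb & ->) (e & he & h).
  assert (hl : forall d : C, Cmod d = 1%R -> forall t : R, (Rabs t < e)%R ->
    (f (z + RtoC t * d)%C <= f (z + RtoC 0 * d)%C)%R).
  { intros d hd t ht. replace (z + RtoC 0 * d) with z by ring. apply h.
    replace (z + RtoC t * d - z) with (RtoC t * d) by ring.
    rewrite Cmod_mult, Cmod_R, hd. lra. }
  apply second_der_max in ha; [apply second_der_max in hb; [lra|]|].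
  - exists e. split; [exact he|]. apply hl, Cmod_Ci.
  - exists e. split; [exact he|]. apply hl, Cmod_1.
Qed.

(** The second derivative of Re H in direction d is Re (d^2 h2), and 1^2 + i^2 = 0. *)
Lemma laplacian_Re (H H1 : C -> C) (z h2 : C) :
  (exists e : R, (0 < e)%R /\
     forall y : C, (Cmod (y - z) < e)%R -> cder H y (H1 y)) ->
  cder H1 z h2 ->
  laplacian (fun y => Re (H y)) z 0%R.
Proof.
  intros (e & he & hH) h1.
  assert (hl : forall d : C, Cmod d = 1%R ->
    second_der (fun t => Re (H (z + RtoC t * d))) (Re (d * h2 * d))).
  { intros d hd. exists (fun t => Re (d * H1 (z + RtoC t * d))). split.
    - exists e. split; [exact he|]. intros t ht.
      rewrite Cmult_comm. apply cder_line_Re, hH.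
      replace (z + RtoC t * d - z) with (RtoC t * d) by ring.
      rewrite Cmod_mult, Cmod_R, hd. lra.
    - apply (cder_line_Re (fun y => d * H1 y)).
      replace (z + RtoC 0 * d) with z by ring. now apply cder_scal. }
  exists (Re (1 * h2 * 1)), (Re (Ci * h2 * Ci)). repeat split.
  - apply hl, Cmod_1.
  - apply hl, Cmod_Ci.
  - unfold Re; simpl; ring.
Qed.

Definition sqnorm (z : C) : R := (Re z ^ 2 + Im z ^ 2)%R.

Lemma sqnorm_Cmod (z : C) : sqnorm z = (Cmod z ^ 2)%R.
Proof. symmetry; apply Cmod2_alt. Qed.

Lemma laplacian_sqnorm (z : C) : laplacian sqnorm z 4%R.
Proof.
  destruct z as [x y]. exists 2%R, 2%R. repeat split; [| |ring].
  - exists (fun t => 2 * (x + t))%R. split.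
    + exists 1%R. split; [lra|]. intros t _.
      unfold sqnorm, Re, Im; simpl. auto_derive; [easy|ring].
    + auto_derive; [easy|ring].
  - exists (fun t => 2 * (y + t))%R. split.
    + exists 1%R. split; [lra|]. intros t _.
      unfold sqnorm, Re, Im; simpl. auto_derive; [easy|ring].
    + auto_derive; [easy|ring].
Qed.

(** Computed in real coordinates, which avoids choosing a branch of the complex logarithm. The two
    second derivatives are opposite to each other. *)
Lemma laplacian_ln_sqnorm (z : C) : z <> 0 -> laplacian (fun y => ln (sqnorm y)) z 0%R.
Proof.
  intros hz. pose proof (proj1 (Cmod_gt_0 _) hz) as hm.
  assert (hpos : forall d : C, Cmod d = 1%R -> forall t : R,
    (Rabs t < Cmod z)%R -> (0 < sqnorm (z + RtoC t * d)%C)%R).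
  { intros d hd t ht. rewrite sqnorm_Cmod. apply pow_lt, Cmod_gt_0. intros h0.
    assert (hz' : z = - (RtoC t * d)).
    { replace z with (z + RtoC t * d + - (RtoC t * d)) by ring. rewrite h0; ring. }
    rewrite hz', Cmod_opp, Cmod_mult, Cmod_R, hd in ht. lra. }
  pose proof (hpos 1 Cmod_1) as h1. pose proof (hpos Ci Cmod_Ci) as hi. clear hpos.
  pose proof (h1 0%R ltac:(rewrite Rabs_R0; lra)) as h10.
  destruct z as [x y]. unfold sqnorm, Re, Im in *; simpl in *.
  set (n := (x ^ 2 + y ^ 2)%R).
  assert (hn : (0 < n)%R) by (unfold n; simpl; nra).
  exists (2 * (y ^ 2 - x ^ 2) / n ^ 2)%R, (2 * (x ^ 2 - y ^ 2) / n ^ 2)%R.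
  repeat split; [| |unfold n in *; field; lra].
  - exists (fun t => 2 * (x + t) / ((x + t) ^ 2 + y ^ 2))%R. split.
    + exists (Cmod (x, y)). split; [exact hm|]. intros t ht. specialize (h1 t ht).
      unfold sqnorm, Re, Im; simpl. auto_derive; [simpl; lra|]. simpl; field; lra.
    + unfold n in *. auto_derive; [simpl in *; lra|]. simpl; field; simpl in *; lra.
  - exists (fun t => 2 * (y + t) / (x ^ 2 + (y + t) ^ 2))%R. split.
    + exists (Cmod (x, y)). split; [exact hm|]. intros t ht. specialize (hi t ht).
      unfold sqnorm, Re, Im; simpl. auto_derive; [simpl; lra|]. simpl; field; lra.
    + unfold n in *. auto_derive; [simpl in *; lra|]. simpl; field; simpl in *; lra.
Qed.

Lemma rcont_plus (f g : C -> R) (z : C) :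
  rcont f z -> rcont g z -> rcont (fun y => f y + g y)%R z.
Proof.
  intros hf hg e he.
  destruct (hf (e / 2)%R) as (d1 & hd1 & h1); [lra|].
  destruct (hg (e / 2)%R) as (d2 & hd2 & h2); [lra|].
  exists (Rmin d1 d2); split; [now apply Rmin_glb_lt|]; intros y hy.
  specialize (h1 y (Rlt_le_trans _ _ _ hy (Rmin_l _ _))).
  specialize (h2 y (Rlt_le_trans _ _ _ hy (Rmin_r _ _))).
  replace (f y + g y - (f z + g z))%R with ((f y - f z) + (g y - g z))%R by ring.
  eapply Rle_lt_trans; [apply Rabs_triang|]; lra.
Qed.

Lemma Cmod_sub_rev (z w : C) : Cmod (z - w) = Cmod (w - z).
Proof. rewrite <- Cmod_opp; f_equal; ring. Qed.

Lemma Cmod_triangle_rev (y z : C) : (Rabs (Cmod y - Cmod z) <= Cmod (y - z))%R.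
Proof.
  pose proof (Cmod_triangle (y - z) z) as h1.
  replace (y - z + z) with y in h1 by ring.
  pose proof (Cmod_triangle (z - y) y) as h2.
  replace (z - y + y) with z in h2 by ring.
  rewrite Cmod_sub_rev in h2. apply Rabs_le_between. lra.
Qed.

Lemma rcont_Cmod (g : R -> R) (z : C) :
  continuity_pt g (Cmod z) -> rcont (fun y => g (Cmod y)) z.
Proof.
  intros hg e he. destruct (hg e he) as (d & hd & h). exists d; split; [exact hd|].
  (* [continuity_pt] speaks only of arguments different from the point, so equal moduli are treated
     apart. *)
  intros y hy. destruct (Req_dec (Cmod z) (Cmod y)) as [h0|h0].
  - rewrite h0, Rminus_diag, Rabs_R0. exact he.
  - apply h. split; [split; [exact I|exact h0]|].
    eapply Rle_lt_trans; [apply Cmod_triangle_rev | exact hy].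
Qed.

(** Lets one error term at a time tend to 0. The sign of c is left open, so the coefficient of the
    error needs no analysis. *)
Lemma le_of_le_eps (a b c : R) :
  (forall e : R, (0 < e)%R -> (a <= b + e * c)%R) -> (a <= b)%R.
Proof.
  intros h. destruct (Rle_or_lt a b) as [hab|hab]; [exact hab|exfalso].
  destruct (Rle_or_lt c 0) as [hc|hc].
  - specialize (h 1%R ltac:(lra)). lra.
  - specialize (h ((a - b) / (2 * c))%R ltac:(apply Rdiv_lt_0_compat; lra)).
    replace ((a - b) / (2 * c) * c)%R with ((a - b) / 2)%R in h by (field; lra). lra.
Qed.

(* Hadamard's proof of Liouville's theorem: on the annulus r <= |z| <= R, compare
   u with d + k log (|z| / r)^2, which dominates u on both circles once R is
   large; then let k and d tend to 0.  The term e |z|^2 makes the Laplacian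
   strictly positive, so that the second derivative test excludes an interior
   maximum. *)
Lemma bounded_harmonic_nonpos (u : C -> R) (S : C -> Prop) (M : R) :
  (forall z, rcont u z) ->
  (forall z, ~ S z -> laplacian u z 0%R) ->
  (forall z, S z -> u z = 0%R) -> S 0 ->
  (forall z, (u z <= M)%R) ->
  forall z, (u z <= 0)%R.
Proof.
  intros hc hlap hS h0 hM z.
  destruct (classic (z = 0)) as [->|hz]; [rewrite hS; auto; lra|].
  pose proof (proj1 (Cmod_gt_0 _) hz) as hm.
  apply (le_of_le_eps _ _ 1). intros del hdel. rewrite Rplus_0_l, Rmult_1_r.
  destruct (hc 0 del hdel) as (d0 & hd0 & hu).
  (* Inside radius r, continuity at 0 and u 0 = 0 give u <= [del]; r <= |z| keeps z in the
     annulus. *)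
  set (r := Rmin (d0 / 2) (Cmod z)).
  assert (hr : (0 < r)%R) by (apply Rmin_glb_lt; lra).
  assert (hrz : (r <= Cmod z)%R) by apply Rmin_r.
  assert (hru : forall y, (Cmod y <= r)%R -> (u y <= del)%R).
  { intros y hy. pose proof (Rmin_l (d0 / 2) (Cmod z)) as h. fold r in h.
    specialize (hu y). replace (y - 0) with y in hu by ring.
    specialize (hu ltac:(lra)). rewrite (hS 0 h0), Rminus_0_r in hu.
    apply Rabs_lt_between in hu. lra. }
  clearbody r.
  apply (le_of_le_eps _ _ (ln (sqnorm z) - ln (r ^ 2))). intros k hk.
  (* The first summand gives k log (T / r)^2 >= 2 |M| >= M, so the comparison function dominates u
     on the outer circle; the second keeps z in the annulus. *)
  set (T := (r * exp (Rabs M / k) + Cmod z)%R).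
  assert (hT : (Cmod z <= T)%R).
  { unfold T. pose proof (exp_pos (Rabs M / k)). nra. }
  assert (hMT : (M <= k * (ln (T ^ 2) - ln (r ^ 2)))%R).
  { assert (hl : (ln r + Rabs M / k <= ln T)%R).
    { rewrite <- (ln_exp (Rabs M / k)), <- ln_mult; [|lra|apply exp_pos].
      left. apply ln_increasing.
      - apply Rmult_lt_0_compat; [lra|apply exp_pos].
      - unfold T; lra. }
    rewrite !ln_pow by lra. simpl INR.
    pose proof (Rle_abs M). pose proof (Rabs_pos M).
    assert (hq : (k * (Rabs M / k) = Rabs M)%R) by (field; lra).
    nra. }
  clearbody T.
  apply (le_of_le_eps _ _ (T ^ 2)). intros e he.
  set (v := fun y => (u y + (- k * ln (sqnorm y) + e * sqnorm y))%R).
  set (A := fun y => (r <= Cmod y <= T)%R).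
  assert (hvc : forall y, A y -> rcont v y).
  { intros y [hy _]. apply rcont_plus; [apply hc|].
    assert (h : rcont (fun y => (fun s => - k * ln (s ^ 2) + e * s ^ 2)%R (Cmod y)) y).
    { apply (rcont_Cmod (fun s => - k * ln (s ^ 2) + e * s ^ 2)%R).
      apply derivable_continuous_pt.
      eexists. apply is_derive_Reals. auto_derive; [|reflexivity].
      simpl; nra. }
    intros x hx. destruct (h x hx) as (d & hd & h'). exists d; split; [exact hd|].
    intros w hw. rewrite !sqnorm_Cmod. exact (h' w hw). }
  destruct (max_attained v A T) as (p & hp & hmax).
  { intros y [_ hy]; exact hy. }
  { intros p hp. unfold A in hp.
    assert (hcase : (Cmod p < r \/ T < Cmod p)%R) by lra.
    exists (Rmax (r - Cmod p) (Cmod p - T)). split.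
    - destruct hcase; [eapply Rlt_le_trans; [|apply Rmax_l] | eapply Rlt_le_trans; [|apply Rmax_r]]; lra.
    - intros y hy [h1 h2].
      pose proof (Cmod_triangle_rev y p) as ht. apply Rabs_le_between in ht.
      destruct hcase; [rewrite Rmax_left in hy by lra | rewrite Rmax_right in hy by lra]; lra. }
  { exact hvc. }
  { exists z; split; assumption. }
  assert (hmain : (v p <= del - k * ln (r ^ 2) + e * T ^ 2)%R).
  { destruct hp as [hp1 hp2].
    assert (hsq : (r ^ 2 <= sqnorm p <= T ^ 2)%R).
    { rewrite sqnorm_Cmod. split; apply pow_incr; lra. }
    assert (hr2 : (0 < r ^ 2)%R) by (apply pow_lt; lra).
    assert (hln : (ln (r ^ 2) <= ln (sqnorm p))%R).
    { destruct (proj1 hsq) as [h| ->]; [left; now apply ln_increasing | lra]. }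
    unfold v.
    (* If the maximum lies in S, then u p = 0 and the bound follows from r <= |p| <= T. This is
       where the points without a known Laplacian are disposed of. *)
    destruct (classic (S p)) as [hSp|hSp]; [rewrite (hS p hSp); nra|].
    destruct (Req_dec (Cmod p) r) as [hpr|hpr].
    { pose proof (hru p ltac:(lra)). nra. }
    destruct (Req_dec (Cmod p) T) as [hpT|hpT].
    { pose proof (hM p). rewrite sqnorm_Cmod, hpT in *. nra. }
    exfalso.
    assert (hp0 : p <> 0) by (intros ->; rewrite Cmod_0 in hp1; lra).
    assert (hl : laplacian v p (0 + (- k * 0 + e * 4))%R).
    { apply laplacian_plus; [now apply hlap|].
      apply laplacian_plus; apply laplacian_scal;
        [now apply laplacian_ln_sqnorm | apply laplacian_sqnorm]. }
    apply laplacian_max in hl; [lra|].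
    exists (Rmin (Cmod p - r) (T - Cmod p)). split; [apply Rmin_glb_lt; lra|].
    intros y hy. apply hmax.
    pose proof (Rlt_le_trans _ _ _ hy (Rmin_l _ _)).
    pose proof (Rlt_le_trans _ _ _ hy (Rmin_r _ _)).
    pose proof (Cmod_triangle_rev y p) as ht. apply Rabs_le_between in ht.
    split; lra. }
  pose proof (hmax z (conj hrz hT)) as hz1. unfold v in hz1, hmain.
  assert (0 <= sqnorm z)%R by (rewrite sqnorm_Cmod; apply pow2_ge_0).
  nra.
Qed.

(** * Quasi-periods of zeta and sigma *)

(** Neighbourhoods in these filters are squares: the square of half side e / 2 lies in the disc of
    radius e, and a disc lies in the square of the same radius. *)
Lemma filterlim_locally'_0 (f : C -> C) :
  filterlim f (locally' (RtoC 0)) (locally (RtoC 0)) ->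
  forall e : R, (0 < e)%R -> exists d : R, (0 < d)%R /\
    forall z : C, z <> 0 -> (Cmod z < d)%R -> (Cmod (f z) < e)%R.
Proof.
  intros hf e he.
  destruct (hf (fun y => (Cmod y < e)%R)) as (d & hd).
  - assert (he2 : (0 < e / 2)%R) by lra. exists (mkposreal _ he2).
    intros y [h1 h2]. eapply Rle_lt_trans; [apply Cmod_le_Rabs|].
    change (Rabs (Re y - 0) < e / 2)%R in h1. change (Rabs (Im y - 0) < e / 2)%R in h2.
    rewrite Rminus_0_r in h1, h2. lra.
  - exists d. split; [apply cond_pos|]. intros z hz hzd. apply hd; [|exact hz].
    split; [change (Rabs (Re z - 0) < d)%R | change (Rabs (Im z - 0) < d)%R];
      rewrite Rminus_0_r; eapply Rle_lt_trans; [apply re_le_Cmod| |apply im_le_Cmod|]; exact hzd.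
Qed.

Lemma cder_local (f g : C -> C) (z l : C) :
  (exists d : R, (0 < d)%R /\ forall y : C, (Cmod (y - z) < d)%R -> f y = g y) ->
  cder f z l -> cder g z l.
Proof.
  intros (d & hd & hfg) (p & hp & <- & hf). apply cder_eps. intros e he.
  destruct (hp e he) as (d' & hd' & h).
  exists (Rmin d d'). split; [now apply Rmin_glb_lt|]. intros y hy.
  specialize (h y (Rlt_le_trans _ _ _ hy (Rmin_r _ _))).
  rewrite <- !hfg.
  2: { replace (z - z) with (RtoC 0) by ring. now rewrite Cmod_0. }
  2: { eapply Rlt_le_trans; [exact hy | apply Rmin_l]. }
  rewrite (hf y).
  replace (f z + p y * (y - z) - f z - p z * (y - z)) with ((p y - p z) * (y - z)) by ring.
  rewrite Cmod_mult. apply Rmult_le_compat_r; [apply Cmod_ge_0 | lra].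
Qed.

Lemma cder_eq (f : C -> C) (z a b : C) : a = b -> cder f z a -> cder f z b.
Proof. now intros ->. Qed.

(** The displacement is real, so that it stays on the line x0 + R that carries the curve. *)
Lemma lattice_codense (Gamma : C -> Prop) : is_lattice Gamma ->
  forall (z : C) (e : R), (0 < e)%R ->
  exists t : R, (Rabs t < e)%R /\ ~ Gamma (z + RtoC t).
Proof.
  intros hG z e he. destruct (classic (Gamma z)) as [hz|hz].
  - destruct (lattice_discrete Gamma hG z hz) as (d & hd & h).
    assert (h0 : (0 < Rmin d e)%R) by now apply Rmin_glb_lt.
    pose proof (Rmin_l d e). pose proof (Rmin_r d e).
    exists (Rmin d e / 2)%R. split; [rewrite Rabs_pos_eq; lra|].
    apply h.
    + replace (z + RtoC (Rmin d e / 2) - z) with (RtoC (Rmin d e / 2)) by ring.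
      rewrite Cmod_R, Rabs_pos_eq; lra.
    + intros h1. apply (f_equal Re) in h1. unfold Re in h1; simpl in h1. lra.
  - exists 0%R. rewrite Rabs_R0. split; [exact he|].
    now replace (z + RtoC 0) with z by ring.
Qed.

Section Weierstrass.

Variables (g2 g3 : R) (Gamma : C -> Prop) (wp zeta sigma : C -> C).
Hypothesis hwp : is_wp g2 g3 Gamma wp.
Hypothesis hzeta : is_zeta Gamma wp zeta.
Hypothesis hsigma : is_sigma Gamma zeta sigma.

Let hG : is_lattice Gamma := wp_lattice _ _ _ _ hwp.

Lemma zeta_cder (z : C) : ~ Gamma z -> cder zeta z (- wp z).
Proof. intros hz. apply is_derive_cder, (zeta_derive _ _ _ hzeta), hz. Qed.

(** The difference zeta (z + w) - zeta z has derivative - wp (z + w) + wp z = 0 off the lattice,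
    whose complement is connected by segments; its value at any one point is the quasi-period. *)
Lemma zeta_quasi_periodic (w : C) : Gamma w ->
  exists eta : C, forall z : C, ~ Gamma z -> zeta (z + w) = zeta z + eta.
Proof.
  intros hw. destruct (lattice_codense Gamma hG 0 1%R ltac:(lra)) as (t & _ & ht).
  set (z0 := 0 + RtoC t) in *.
  exists (zeta (z0 + w) - zeta z0). intros z hz.
  assert (h : forall y, ~ Gamma y -> cder (fun y => zeta (y + w) + - (1) * zeta y) y 0).
  { intros y hy. assert (hyw : ~ Gamma (y + w)) by (rewrite lattice_shift; auto).
    apply (cder_eq _ _ (- wp (y + w) + - (1) * - wp y)).
    - rewrite (proj1 (wp_periods _ _ _ _ hwp w) hw y hy hyw). ring.
    - apply cder_plus; [apply cder_shift | apply cder_scal]; now apply zeta_cder. }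
  pose proof (lattice_cder_0 Gamma hG _ h z z0 hz ht) as he. simpl in he.
  replace (zeta (z + w)) with (zeta (z + w) + - (1) * zeta z + zeta z) by ring.
  rewrite he. ring.
Qed.

(** Twice the even part of zeta. Its poles cancel, and the value 0 on the lattice is the one that
    makes it continuous there. *)
Let even_part (z : C) : C :=
  if excluded_middle_informative (Gamma z) then 0 else zeta z + zeta (- z).

Lemma even_part_lattice (z : C) : Gamma z -> even_part z = 0.
Proof. intros h; unfold even_part. now destruct excluded_middle_informative. Qed.

Lemma even_part_off (z : C) : ~ Gamma z -> even_part z = zeta z + zeta (- z).
Proof. intros h; unfold even_part. now destruct excluded_middle_informative. Qed.

(** The quasi-period of w is added at z and subtracted at - z, so it cancels. *)
Lemma even_part_periodic (z w : C) : Gamma w -> even_part (z + w) = even_part z.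
Proof.
  intros hw. destruct (classic (Gamma z)) as [hz|hz].
  - rewrite !even_part_lattice; auto. now apply lattice_shift.
  - assert (hzw : ~ Gamma (z + w)) by (rewrite lattice_shift; auto).
    rewrite !even_part_off by auto.
    destruct (zeta_quasi_periodic w hw) as (eta & h).
    rewrite (h z hz). replace (- z) with (- (z + w) + w) by ring.
    rewrite (h (- (z + w))); [ring|]. rewrite lattice_opp_iff; auto.
Qed.

Lemma even_part_cder (z : C) : ~ Gamma z -> cder even_part z (- wp z + wp (- z)).
Proof.
  intros hz.
  apply (cder_local (fun y => zeta y + zeta (- y))).
  { destruct (lattice_closed Gamma hG z hz) as (d & hd & h).
    exists d; split; [exact hd|]. intros y hy. symmetry. apply even_part_off; auto. }
  apply cder_plus; [now apply zeta_cder|].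
  apply (cder_eq _ _ (- - wp (- z))); [ring|].
  apply cder_reflect, zeta_cder. now rewrite lattice_opp_iff.
Qed.

Lemma even_part_ccont (z : C) : ccont even_part z.
Proof.
  destruct (classic (Gamma z)) as [hz|hz].
  - intros e he.
    destruct (filterlim_locally'_0 _ (zeta_at_0 _ _ _ hzeta) (e / 2)%R) as (d & hd & h); [lra|].
    exists d; split; [exact hd|]. intros y hy.
    rewrite (even_part_lattice z hz).
    replace (even_part y - 0) with (even_part (y - z + z)) by (replace (y - z + z) with y by ring; ring).
    rewrite even_part_periodic by auto. set (x := y - z) in *.
    destruct (classic (Gamma x)) as [hx|hx].
    { rewrite even_part_lattice, Cmod_0; auto. }
    rewrite even_part_off by auto.
    assert (hx0 : x <> 0) by (intros h0; apply hx; rewrite h0; now apply lattice_0).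
    assert (hx1 : - x <> 0).
    { intros h0; apply hx0. replace x with (- - x) by ring. rewrite h0; ring. }
    (* The principal parts 1 / x and 1 / (- x) cancel, and the normalisation of zeta at 0 bounds
       each bracket by e / 2. *)
    replace (zeta x + zeta (- x)) with ((zeta x - 1 / x) + (zeta (- x) - 1 / - x))
      by (field; auto).
    eapply Rle_lt_trans; [apply Cmod_triangle|].
    pose proof (h x hx0 hy). pose proof (h (- x) hx1 ltac:(rewrite Cmod_opp; exact hy)).
    lra.
  - eapply cder_ccont. now apply even_part_cder.
Qed.

Lemma even_part_bounded : exists K : R, forall z : C, (Cmod (even_part z) <= K)%R.
Proof.
  destruct (lattice_fundamental Gamma hG) as (b & hb & hfund).
  destruct (disc_compact b (fun d y => (Cmod (even_part y) <= / d)%R)) as (d & hd & h).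
  - intros d d' y [h1 h2] h. eapply Rle_trans; [exact h|].
    now apply Rinv_le_contravar.
  - intros p. destruct (even_part_ccont p 1%R ltac:(lra)) as (d & hd & h).
    pose proof (Cmod_ge_0 (even_part p)) as hp.
    assert (hi : (0 < / (Cmod (even_part p) + 1))%R) by (apply Rinv_0_lt_compat; lra).
    exists (Rmin d (/ (Cmod (even_part p) + 1))). split; [now apply Rmin_glb_lt|].
    intros y hy. specialize (h y (Rlt_le_trans _ _ _ hy (Rmin_l _ _))).
    pose proof (Cmod_triangle (even_part p) (even_part y - even_part p)) as ht.
    replace (even_part p + (even_part y - even_part p)) with (even_part y) in ht by ring.
    apply Rle_trans with (Cmod (even_part p) + 1)%R; [lra|].
    rewrite <- (Rinv_inv (Cmod (even_part p) + 1)) at 1.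
    apply Rinv_le_contravar; [now apply Rmin_glb_lt | apply Rmin_r].
  - exists (/ d)%R. intros z. destruct (hfund z) as (w & hw & hzw).
    replace z with (z - w + w) by ring. rewrite even_part_periodic by auto. auto.
Qed.

Lemma even_part_0 (z : C) : even_part z = 0.
Proof.
  (* With this multiplier the real part at z is |even_part z|^2, so a one-sided bound by 0 already
     forces the value to vanish. *)
  set (c := Cconj (even_part z)).
  destruct even_part_bounded as (K & hK).
  assert (h : (Re (c * even_part z) <= 0)%R).
  { apply (bounded_harmonic_nonpos (fun y => Re (c * even_part y)) Gamma (Cmod c * K)).
    - intros y e he.
      destruct (ccont_mult (fun _ => c) even_part y (ccont_const c y) (even_part_ccont y) e he)
        as (d & hd & hy).
      exists d; split; [exact hd|]. intros x hx.
      replace (Re (c * even_part x) - Re (c * even_part y))%R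
        with (Re (c * even_part x - c * even_part y)) by (unfold Re; simpl; ring).
      eapply Rle_lt_trans; [apply re_le_Cmod | auto].
    - intros y hy.
      destruct (wp_ode _ _ _ _ hwp y hy) as (a & ha & _).
      destruct (wp_ode _ _ _ _ hwp (- y)) as (b & hb & _); [now rewrite lattice_opp_iff|].
      apply (laplacian_Re _ (fun x => c * (- (1) * wp x + wp (- x))) y (c * (- (1) * a + - b))).
      + destruct (lattice_closed Gamma hG y hy) as (d & hd & h).
        exists d; split; [exact hd|]. intros x hx. apply cder_scal.
        apply (cder_eq _ _ (- wp x + wp (- x))); [ring|].
        apply even_part_cder; auto.
      + apply cder_scal, cder_plus.
        * apply cder_scal, is_derive_cder, ha.
        * apply cder_reflect, is_derive_cder, hb.
    - intros y hy. rewrite even_part_lattice by auto. unfold Re; simpl; ring.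
    - now apply lattice_0.
    - intros y. pose proof (re_le_Cmod (c * even_part y)) as h.
      rewrite Cmod_mult in h. pose proof (Rle_abs (Re (c * even_part y))).
      pose proof (hK y). pose proof (Cmod_ge_0 c). nra. }
  apply Cmod_eq_0. unfold c in h.
  rewrite Cmult_comm, <- Cmod2_conj in h.
  pose proof (Cmod_ge_0 (even_part z)).
  change (Re (RtoC (Cmod (even_part z) ^ 2))) with (Cmod (even_part z) ^ 2)%R in h. nra.
Qed.

Lemma zeta_odd (z : C) : ~ Gamma z -> zeta (- z) = - zeta z.
Proof.
  intros hz. pose proof (even_part_0 z) as h. rewrite even_part_off in h by auto.
  replace (zeta (- z)) with (zeta z + zeta (- z) + - zeta z) by ring. rewrite h; ring.
Qed.

(** Evaluating the quasi-periodicity at - w gives zeta w = zeta (- w) + eta, and oddness turns this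
    into eta = 2 zeta w. *)
Lemma zeta_half_period (w z : C) : Gamma (2 * w) -> ~ Gamma w -> ~ Gamma z ->
  zeta (z + 2 * w) = zeta z + 2 * zeta w.
Proof.
  intros hw hw' hz. destruct (zeta_quasi_periodic _ hw) as (eta & h).
  rewrite (h z hz). f_equal.
  assert (hn : ~ Gamma (- w)) by now rewrite lattice_opp_iff.
  pose proof (h (- w) hn) as he.
  replace (- w + 2 * w) with w in he by ring. rewrite zeta_odd in he by auto.
  replace eta with (- zeta w + eta + zeta w) by ring. rewrite <- he. ring.
Qed.

Lemma sigma_neq_0 (z : C) : ~ Gamma z -> sigma z <> 0.
Proof. intros hz. now destruct (sigma_logderive _ _ _ hsigma z hz) as (d & _ & h & _). Qed.

Lemma sigma_cder (z : C) : ~ Gamma z -> cder sigma z (zeta z * sigma z).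
Proof.
  intros hz. destruct (sigma_logderive _ _ _ hsigma z hz) as (d & hd & h & <-).
  apply (cder_eq _ _ d); [field; auto | now apply is_derive_cder].
Qed.

Lemma sigma_ccont (z : C) : ccont sigma z.
Proof.
  destruct (sigma_entire _ _ _ hsigma z) as (d & hd).
  eapply cder_ccont, is_derive_cder, hd.
Qed.

(** The quotient of the two sides has logarithmic derivative zeta (z + w) - eta - zeta z = 0. The
    constant c stays implicit, since it cancels in the coordinates of the curve. *)
Lemma sigma_quasi_periodic (w eta : C) : Gamma w ->
  (forall z : C, ~ Gamma z -> zeta (z + w) = zeta z + eta) ->
  exists c : C, c <> 0 /\ forall z : C, sigma (z + w) = c * Cexp (eta * z) * sigma z.
Proof.
  intros hw heta.
  set (f := fun z => sigma (z + w) * (Cexp (- eta * z) * / sigma z)).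
  assert (hf : forall z, ~ Gamma z -> cder f z 0).
  { intros z hz. assert (hzw : ~ Gamma (z + w)) by (rewrite lattice_shift; auto).
    pose proof (sigma_neq_0 z hz) as hs.
    eapply cder_eq.
    2: { apply cder_mult; [apply cder_shift, sigma_cder, hzw|].
         apply cder_mult; [apply cder_Cexp_scal|].
         apply (cder_comp Cinv sigma); [apply cder_inv, hs | apply sigma_cder, hz]. }
    rewrite (heta z hz). simpl. field; auto. }
  destruct (lattice_codense Gamma hG 0 1%R ltac:(lra)) as (t & _ & ht).
  set (z0 := 0 + RtoC t) in *.
  assert (hoff : forall z, ~ Gamma z -> sigma (z + w) = f z0 * Cexp (eta * z) * sigma z).
  { intros z hz. rewrite <- (lattice_cder_0 Gamma hG f hf z z0 hz ht). unfold f.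
    pose proof (Cexp_opp (eta * z)) as he.
    replace (- (eta * z)) with (- eta * z) in he by ring.
    pose proof (sigma_neq_0 z hz) as hs.
    replace (sigma (z + w)) with (sigma (z + w) * (Cexp (eta * z) * Cexp (- eta * z)))
      at 1 by (rewrite he; ring).
    field; auto. }
  exists (f z0). split.
  { assert (hzw : ~ Gamma (z0 + w)) by (rewrite lattice_shift; auto).
    unfold f. repeat apply Cmult_neq_0; [now apply sigma_neq_0 | apply Cexp_neq_0|].
    intros h0. apply C1_nz. rewrite <- (Cinv_r (sigma z0)) by now apply sigma_neq_0.
    rewrite h0; ring. }
  (* The identity is also needed on the lattice, because numerators of the curve may be evaluated
     there. The difference D of the sides is continuous and vanishes on the dense complement. *)
  intros z. apply NNPP. intros hne.
  set (D := fun z => sigma (z + w) + - (1) * (f z0 * Cexp (eta * z) * sigma z)).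
  assert (hD : ccont D z).
  { apply ccont_plus.
    - apply (ccont_comp sigma (fun y => y + w)); [apply sigma_ccont|].
      apply ccont_plus; [apply ccont_id | apply ccont_const].
    - apply ccont_mult; [apply ccont_const|].
      apply ccont_mult; [|apply sigma_ccont].
      apply ccont_mult; [apply ccont_const|].
      eapply cder_ccont, cder_Cexp_scal. }
  assert (hDz : D z <> 0).
  { intros h0. apply hne. unfold D in h0.
    replace (sigma (z + w)) with (sigma (z + w) + - (1) * (f z0 * Cexp (eta * z) * sigma z)
      + f z0 * Cexp (eta * z) * sigma z) by ring.
    rewrite h0; ring. }
  destruct (hD (Cmod (D z)) (proj1 (Cmod_gt_0 _) hDz)) as (d & hd & h).
  destruct (lattice_codense Gamma hG z d hd) as (s & hs & hsG).
  specialize (h (z + RtoC s)).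
  replace (z + RtoC s - z) with (RtoC s) in h by ring. rewrite Cmod_R in h.
  specialize (h hs).
  replace (D (z + RtoC s)) with (RtoC 0) in h.
  2: { unfold D. rewrite (hoff _ hsG). ring. }
  replace (0 - D z) with (- D z) in h by ring. rewrite Cmod_opp in h. lra.
Qed.

End Weierstrass.

(** * The projective line *)

Lemma spanned_by_det (v w : C * C) : v <> (RtoC 0, RtoC 0) ->
  fst v * snd w = snd v * fst w -> spanned_by v w.
Proof.
  destruct v as [a b], w as [c d]; simpl. intros hv h.
  destruct (classic (a = 0)) as [ha|ha].
  - assert (hb : b <> 0) by (intros hb; apply hv; now rewrite ha, hb).
    exists (d / b). simpl. f_equal; [|field; auto].
    replace c with (b * c / b) by (field; auto). rewrite <- h. field; auto.
  - exists (c / a). simpl. f_equal; [field; auto|].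
    replace d with (a * d / a) by (field; auto). rewrite h. field; auto.
Qed.

Lemma mkCP1_ext (l l' : C * C -> Prop) h h' :
  (forall w, l w <-> l' w) -> mkCP1 l h = mkCP1 l' h'.
Proof.
  intros hl. assert (l = l') as ->.
  { apply functional_extensionality; intros w; apply propositional_extensionality, hl. }
  f_equal. apply proof_irrelevance.
Qed.

Lemma RtoC_neq_0 (x : R) : x <> 0%R -> RtoC x <> 0.
Proof. intros h h'. apply h. now apply RtoC_inj in h'. Qed.

Lemma proj_eq_iff (v w : C * C) hv hw :
  proj v hv = proj w hw <-> fst v * snd w = snd v * fst w.
Proof.
  split.
  - intros h. apply (f_equal line) in h. simpl in h.
    assert (hs : spanned_by v w).
    { rewrite h. exists 1. destruct w; simpl; f_equal; ring. }
    destruct hs as (c & ->). simpl; ring.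
  - intros h. apply mkCP1_ext.
    assert (hs : forall v w : C * C, spanned_by v w -> forall y, spanned_by w y -> spanned_by v y).
    { intros v0 w0 (c & ->) y (c' & ->). exists (c' * c); simpl; f_equal; ring. }
    intros y; split; apply hs; apply spanned_by_det; auto.
    rewrite Cmult_comm, <- h, Cmult_comm. reflexivity.
Qed.

Lemma proj_surj (p : CP1) : exists v hv, p = proj v hv.
Proof.
  destruct p as [l hl]. pose proof hl as (v & hv & h). exists v, hv.
  now apply mkCP1_ext.
Qed.

(** Vanishes exactly when nonzero v and w span the same line; its modulus serves as a gauge of
    distance between lines. *)
Definition det2 (v w : C * C) : C := fst v * snd w - snd v * fst w.

Lemma det2_scal_r (a v : C * C) (c : C) :
  det2 a (c * fst v, c * snd v) = c * det2 a v.
Proof. unfold det2; simpl. ring. Qed.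

Lemma det2_lipschitz (a v w : C * C) (e : R) :
  (Cmod (fst w - fst v) <= e)%R -> (Cmod (snd w - snd v) <= e)%R ->
  (Cmod (det2 a w - det2 a v) <= (Cmod (fst a) + Cmod (snd a)) * e)%R.
Proof.
  intros h1 h2.
  replace (det2 a w - det2 a v)
    with (fst a * (snd w - snd v) + - (snd a * (fst w - fst v))) by (unfold det2; ring).
  eapply Rle_trans; [apply Cmod_triangle|]. rewrite Cmod_opp, !Cmod_mult.
  pose proof (Cmod_ge_0 (fst a)). pose proof (Cmod_ge_0 (snd a)). nra.
Qed.

(** The inequality is homogeneous in v, hence a property of the line, and it is stable under small
    changes of v by the Lipschitz bound. *)
Lemma open_CP1_det (a b : C * C) :
  open_CP1 (fun p => exists v hv, p = proj v hv /\
    (Cmod (det2 a v) < Cmod (det2 b v))%R).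
Proof.
  intros v (hv & v' & hv' & heq & hlt).
  set (K := (Cmod (fst a) + Cmod (snd a) + (Cmod (fst b) + Cmod (snd b)) + 1)%R).
  pose proof (Cmod_ge_0 (fst a)). pose proof (Cmod_ge_0 (snd a)).
  pose proof (Cmod_ge_0 (fst b)). pose proof (Cmod_ge_0 (snd b)).
  assert (hK : (0 < K)%R) by (unfold K; lra).
  assert (hv2 : (Cmod (det2 a v) < Cmod (det2 b v))%R).
  { assert (hs : spanned_by v v').
    { apply spanned_by_det; [exact hv|]. apply (proj_eq_iff v v' hv hv'), heq. }
    destruct hs as (c & ->). rewrite !det2_scal_r, !Cmod_mult in hlt.
    apply (Rmult_lt_reg_l (Cmod c)); [|exact hlt].
    destruct (Rle_lt_or_eq_dec _ _ (Cmod_ge_0 c)) as [hc|hc]; [exact hc|].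
    rewrite <- hc in hlt. lra. }
  (* Each coordinate of v moves by at most 2 e, so the two determinants together change by at most 2
     K e, half of the gap 4 K e. *)
  set (e := ((Cmod (det2 b v) - Cmod (det2 a v)) / (4 * K))%R).
  assert (he : (0 < e)%R) by (apply Rdiv_lt_0_compat; lra).
  exists (mkposreal e he). intros w [hw1 hw2].
  assert (hball : forall x y : C, ball x e y -> (Cmod (y - x) <= 2 * e)%R).
  { intros x y [h1 h2]. change (Rabs (Re y - Re x) < e)%R in h1.
    change (Rabs (Im y - Im x) < e)%R in h2.
    eapply Rle_trans; [apply Cmod_le_Rabs|].
    change (Rabs (Re y - Re x) + Rabs (Im y - Im x) <= 2 * e)%R. lra. }
  apply hball in hw1. apply hball in hw2. clear hball.
  assert (hdet : forall c : C * C, (Cmod (det2 c w - det2 c v)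
            <= (Cmod (fst c) + Cmod (snd c)) * (2 * e))%R).
  { intros c. now apply det2_lipschitz. }
  assert (hlt' : (Cmod (det2 a w) < Cmod (det2 b w))%R).
  { pose proof (hdet a) as h1. pose proof (hdet b) as h2.
    pose proof (Cmod_triangle_rev (det2 a w) (det2 a v)) as h3.
    pose proof (Cmod_triangle_rev (det2 b w) (det2 b v)) as h4.
    apply Rabs_le_between in h3. apply Rabs_le_between in h4.
    assert (heK : (4 * K * e = Cmod (det2 b v) - Cmod (det2 a v))%R)
      by (unfold e; field; lra).
    unfold K in heK. nra. }
  assert (hw : w <> (RtoC 0, RtoC 0)).
  { intros ->. unfold det2 in hlt'; simpl in hlt'.
    rewrite !Cmult_0_r in hlt'. lra. }
  exists hw, w, hw. split; [reflexivity | exact hlt'].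
Qed.

(** The lines closer to p than to q, and those closer to q, as measured by [det2], form disjoint
    open sets. *)
Lemma CP1_separated (p q : CP1) : p <> q ->
  exists U V : CP1 -> Prop, open_CP1 U /\ open_CP1 V /\ U p /\ V q /\
    forall x, U x -> V x -> False.
Proof.
  intros hpq. destruct (proj_surj p) as (a & ha & ->).
  destruct (proj_surj q) as (b & hb & ->).
  assert (hdet : (0 < Cmod (det2 a b))%R).
  { apply Cmod_gt_0. intros h0. apply hpq, proj_eq_iff.
    replace (fst a * snd b) with (det2 a b + snd a * fst b) by (unfold det2; ring).
    rewrite h0; ring. }
  assert (hself : forall v, det2 v v = 0) by (intros; unfold det2; ring).
  assert (hopp : det2 b a = - det2 a b) by (unfold det2; ring).
  exists (fun p => exists v hv, p = proj v hv /\ (Cmod (det2 a v) < Cmod (det2 b v))%R),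
    (fun p => exists v hv, p = proj v hv /\ (Cmod (det2 b v) < Cmod (det2 a v))%R).
  repeat split; try apply open_CP1_det.
  - exists a, ha. split; [reflexivity|]. rewrite hself, hopp, Cmod_opp, Cmod_0. exact hdet.
  - exists b, hb. split; [reflexivity|]. rewrite hself, Cmod_0. exact hdet.
  - intros x (v & hv & -> & h1) (w & hw & heq & h2).
    apply proj_eq_iff in heq. apply spanned_by_det in heq; [|exact hv].
    destruct heq as (c & ->). rewrite !det2_scal_r, !Cmod_mult in h2. pose proof (Cmod_ge_0 c). nra.
Qed.

(** If the values at x + t and x differed, disjoint neighbourhoods of them would both contain
    [gamma y] for some y in D near x. *)
Lemma continuous_CP1_has_period (gamma : R -> CP1) (D : R -> Prop) (t : R) :
  continuous_CP1 gamma ->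
  (forall (x e : R), (0 < e)%R -> exists y, (Rabs (y - x) < e)%R /\ D y) ->
  (forall x, D x -> gamma (x + t)%R = gamma x) ->
  has_period gamma t.
Proof.
  intros hc hD h x. apply NNPP. intros hne.
  destruct (CP1_separated _ _ hne) as (U & V & hU & hV & hUx & hVx & hUV).
  destruct (hc U hU _ hUx) as (d & hd). destruct (hc V hV _ hVx) as (d' & hd').
  destruct (hD x (Rmin d d')) as (y & hy & hyD).
  { apply Rmin_glb_lt; apply cond_pos. }
  apply (hUV (gamma y)).
  - rewrite <- (h y hyD). apply hd.
    change (Rabs ((y + t) - (x + t)) < d)%R.
    replace (y + t - (x + t))%R with (y - x)%R by ring.
    eapply Rlt_le_trans; [exact hy | apply Rmin_l].
  - apply hd'. change (Rabs (y - x) < d')%R.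
    eapply Rlt_le_trans; [exact hy | apply Rmin_r].
Qed.

Lemma Cexp_eq_1 (z : C) :
  Cexp z = 1 <-> exists m : Z, z = 2 * (RtoC (IZR m) * RtoC PI * Ci).
Proof.
  split.
  - destruct z as [a b]. unfold Cexp; simpl. intros h.
    pose proof (f_equal Re h) as h1. pose proof (f_equal Im h) as h2.
    unfold Re, Im in h1, h2; simpl in h1, h2.
    pose proof (exp_pos a) as ha. pose proof (sin2_cos2 b) as hsc. unfold Rsqr in hsc.
    assert (hs : sin b = 0%R) by (apply Rmult_integral in h2; destruct h2; lra).
    assert (hcb : (cos b = 1)%R).
    { rewrite hs in hsc. assert ((cos b - 1) * (cos b + 1) = 0)%R by nra.
      apply Rmult_integral in H. destruct H; [lra|].
      assert (cos b = -1)%R by lra. nra. }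
    rewrite hcb, Rmult_1_r in h1.
    assert (ha0 : a = 0%R) by (apply exp_inv; rewrite exp_0; exact h1).
    (* The zeros of sin b alone would give b in pi Z; from cos b = 1 and 1 - cos b = 2 sin^2 (b / 2)
       one gets b / 2 in pi Z. *)
    assert (hh : sin (b / 2) = 0%R).
    { pose proof (cos_2a_sin (b / 2)) as hd.
      replace (2 * (b / 2))%R with b in hd by field. nra. }
    apply sin_eq_0_0 in hh. destruct hh as (m & hm).
    exists m. apply injective_projections; simpl; [rewrite ha0; ring | lra].
  - intros (m & ->).
    replace (2 * (RtoC (IZR m) * RtoC PI * Ci)) with ((0, 2 * IZR m * PI)%R : C)
      by (apply injective_projections; simpl; ring).
    unfold Cexp; simpl. rewrite exp_0.
    assert (h : sin (IZR m * PI) = 0%R) by (apply sin_eq_0_1; eauto).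
    replace (2 * IZR m * PI)%R with (2 * (IZR m * PI))%R by ring.
    rewrite cos_2a_sin, sin_2a, h. apply injective_projections; simpl; ring.
Qed.

(** * The curve *)

Section Curve.

Variables (g2 g3 : R) (Gamma : C -> Prop) (wp zeta sigma : C -> C).
Hypothesis hwp : is_wp g2 g3 Gamma wp.
Hypothesis hzeta : is_zeta Gamma wp zeta.
Hypothesis hsigma : is_sigma Gamma zeta sigma.
Variables rho x0 : C.

Let hG : is_lattice Gamma := wp_lattice _ _ _ _ hwp.

Lemma ghat_shift (t x : R) (eta : C) : Gamma (RtoC t) ->
  (forall z, ~ Gamma z -> zeta (z + RtoC t) = zeta z + eta) ->
  ~ Gamma (RtoC x + x0) ->
  ghat1 zeta sigma rho x0 (x + t)
    = Cexp (- (eta * rho - zeta rho * RtoC t)) * ghat1 zeta sigma rho x0 x /\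
  ghat2 zeta sigma rho x0 (x + t)
    = Cexp (eta * rho - zeta rho * RtoC t) * ghat2 zeta sigma rho x0 x.
Proof.
  intros ht heta hx.
  destruct (sigma_quasi_periodic g2 g3 Gamma wp zeta sigma hwp hsigma _ _ ht heta)
    as (c & hc & h).
  pose proof (sigma_neq_0 Gamma zeta sigma hsigma _ hx) as hs.
  unfold ghat1, ghat2. set (z := RtoC x + x0) in *.
  replace (RtoC (x + t) + x0) with (z + RtoC t) by (unfold z; rewrite RtoC_plus; ring).
  replace (z + RtoC t - rho) with (z - rho + RtoC t) by ring.
  replace (z + RtoC t + rho) with (z + rho + RtoC t) by ring.
  rewrite !h.
  replace (eta * (z - rho)) with (eta * z + - (eta * rho)) by ring.
  replace (eta * (z + rho)) with (eta * z + eta * rho) by ring.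
  replace (zeta rho * (z + RtoC t)) with (zeta rho * z + zeta rho * RtoC t) by ring.
  replace (- zeta rho * (z + RtoC t)) with (- zeta rho * z + - (zeta rho * RtoC t)) by ring.
  replace (- (eta * rho - zeta rho * RtoC t)) with (- (eta * rho) + zeta rho * RtoC t) by ring.
  replace (eta * rho - zeta rho * RtoC t) with (eta * rho + - (zeta rho * RtoC t)) by ring.
  rewrite !Cexp_plus.
  pose proof (Cexp_neq_0 (eta * z)) as he.
  split; field; auto.
Qed.

(** Supplies a parameter at which both coordinates are finite and nonzero. Three real displacements
    secure the conditions one by one, each small enough not to spoil the open conditions already
    won. *)
Lemma generic_point : exists x : R, ~ Gamma (RtoC x + x0) /\
  ~ Gamma (RtoC x + x0 - rho) /\ ~ Gamma (RtoC x + x0 + rho).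
Proof.
  destruct (lattice_codense Gamma hG x0 1%R ltac:(lra)) as (a & _ & ha).
  destruct (lattice_closed Gamma hG _ ha) as (d & hd & h).
  destruct (lattice_codense Gamma hG (x0 + RtoC a - rho) d hd) as (b & hb & hb').
  destruct (lattice_closed Gamma hG _ hb') as (d' & hd' & h').
  destruct (lattice_codense Gamma hG (x0 + RtoC a + RtoC b + rho)
    (* The first condition must survive b + c, the second only c. *)
    (Rmin d' (d - Rabs b)) ltac:(apply Rmin_glb_lt; lra)) as (c & hc & hc').
  pose proof (Rlt_le_trans _ _ _ hc (Rmin_l _ _)).
  pose proof (Rlt_le_trans _ _ _ hc (Rmin_r _ _)).
  exists (a + b + c)%R. rewrite !RtoC_plus. repeat split.
  - apply h. replace (RtoC a + RtoC b + RtoC c + x0 - (x0 + RtoC a)) with (RtoC b + RtoC c) by ring.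
    rewrite <- RtoC_plus, Cmod_R. eapply Rle_lt_trans; [apply Rabs_triang|]. lra.
  - apply h'. replace (RtoC a + RtoC b + RtoC c + x0 - rho - (x0 + RtoC a - rho + RtoC b))
      with (RtoC c) by ring.
    rewrite Cmod_R. lra.
  - now replace (RtoC a + RtoC b + RtoC c + x0 + rho)
      with (x0 + RtoC a + RtoC b + rho + RtoC c) by ring.
Qed.

(** With p the product of the two coordinates, cross-multiplication turns equality of the lines into
    exp (- a) p = exp a p. Where p <> 0 this says exp (2 a) = 1; conversely exp (2 a) = 1 gives it
    on the dense set of regular parameters. *)
Lemma has_period_iff (gamma : R -> CP1) (t : R) (eta : C) :
  is_gamma_E Gamma zeta sigma rho x0 gamma -> Gamma (RtoC t) ->
  (forall z, ~ Gamma z -> zeta (z + RtoC t) = zeta z + eta) ->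
  has_period gamma t <->
  exists m : Z, eta * rho - zeta rho * RtoC t = RtoC (IZR m) * RtoC PI * Ci.
Proof.
  intros [hcont hgam] ht heta. set (a := eta * rho - zeta rho * RtoC t).
  assert (ha : (exists m : Z, a = RtoC (IZR m) * RtoC PI * Ci) <-> Cexp a * Cexp a = 1).
  { rewrite <- Cexp_plus, Cexp_eq_1. split; intros (m & hm); exists m.
    - rewrite hm; ring.
    - replace a with ((a + a) / 2) by field.
      rewrite hm. field. }
  rewrite ha. clear ha. pose proof (Cexp_opp a) as hopp.
  assert (hx : forall x : R, ~ Gamma (RtoC x + x0) ->
    (gamma (x + t)%R = gamma x <->
     Cexp (- a) * (ghat1 zeta sigma rho x0 x * ghat2 zeta sigma rho x0 x)
     = Cexp a * (ghat1 zeta sigma rho x0 x * ghat2 zeta sigma rho x0 x))).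
  { intros x hx.
    assert (hxt : ~ Gamma (RtoC (x + t) + x0)).
    { replace (RtoC (x + t) + x0) with (RtoC x + x0 + RtoC t) by (rewrite RtoC_plus; ring).
      rewrite lattice_shift; auto. }
    destruct (hgam x hx) as (hv & ->). destruct (hgam _ hxt) as (hv' & ->).
    rewrite proj_eq_iff. simpl.
    destruct (ghat_shift t x eta ht heta hx) as [-> ->]. fold a.
    split; intros h.
    - rewrite Cmult_assoc, h; ring.
    - rewrite <- Cmult_assoc, h; ring. }
  split.
  - intros hp. destruct generic_point as (x & h0 & h1 & h2).
    pose proof (proj1 (hx x h0) (hp x)) as h.
    pose proof (sigma_neq_0 Gamma zeta sigma hsigma _ h0) as s0.
    pose proof (sigma_neq_0 Gamma zeta sigma hsigma _ h1) as s1.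
    pose proof (sigma_neq_0 Gamma zeta sigma hsigma _ h2) as s2.
    assert (hn : ghat1 zeta sigma rho x0 x * ghat2 zeta sigma rho x0 x <> 0).
    { unfold ghat1, ghat2.
      repeat apply Cmult_neq_0; auto using Cexp_neq_0;
        intros hi; apply C1_nz; rewrite <- (Cinv_r _ s0), hi; ring. }
    set (p := ghat1 zeta sigma rho x0 x * ghat2 zeta sigma rho x0 x) in *.
    assert (he : Cexp (- a) = Cexp a).
    { replace (Cexp (- a)) with (Cexp (- a) * p / p) by (field; auto).
      rewrite h. field; auto. }
    rewrite <- he at 2. exact hopp.
  - intros he. apply (continuous_CP1_has_period gamma (fun x => ~ Gamma (RtoC x + x0))).
    + exact hcont.
    + intros x e hepos.
      destruct (lattice_codense Gamma hG (RtoC x + x0) e hepos) as (s & hs & hs').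
      exists (x + s)%R. replace (x + s - x)%R with s by ring. split; [exact hs|].
      now replace (RtoC (x + s) + x0) with (RtoC x + x0 + RtoC s) by (rewrite RtoC_plus; ring).
    + intros x hx0. apply hx; [exact hx0|]. f_equal.
      replace (Cexp (- a)) with (Cexp a * Cexp a * Cexp (- a)) by (rewrite he; ring).
      rewrite <- Cmult_assoc, hopp. ring.
Qed.

End Curve.

(** * The closing number as a denominator *)

Theorem proposition4
  (g2 g3 : R) (hdisc : (g2 ^ 3 - 27 * g3 ^ 2)%R <> 0%R)
  (Gamma : C -> Prop) (wp zeta sigma : C -> C)
  (hwp : is_wp g2 g3 Gamma wp)
  (hzeta : is_zeta Gamma wp zeta)
  (hsigma : is_sigma Gamma zeta sigma)
  (omega1 : R) (homega1 : (0 < omega1)%R)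
  (hgen : forall x : R,
     Gamma (RtoC x) <-> exists k : Z, x = (IZR k * (2 * omega1))%R)
  (eta1 : C) (heta1 : eta1 = zeta (RtoC omega1))
  (E : R) (rho : C) (hrho : ~ Gamma rho) (hE : RtoC E = wp rho)
  (hbranch : ~ branch_value g2 g3 (RtoC E))
  (x0 : C) (gamma_E : R -> CP1)
  (hgamma : is_gamma_E Gamma zeta sigma rho x0 gamma_E)
  (n : nat) (hn : (1 <= n)%nat) :
  closes_after gamma_E omega1 n <->
  exists m : Z,
    Z.gcd m (Z.of_nat n) = 1%Z /\
    2 * eta1 * rho - 2 * zeta rho * RtoC omega1
      = RtoC (IZR m / INR n)%R * RtoC PI * Ci.
Proof.
  set (a := 2 * eta1 * rho - 2 * zeta rho * RtoC omega1).
  assert (hG : is_lattice Gamma) by exact (wp_lattice _ _ _ _ hwp).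
  assert (hw : Gamma (2 * RtoC omega1)).
  { rewrite <- RtoC_mult. apply hgen. exists 1%Z. ring. }
  assert (hw1 : ~ Gamma (RtoC omega1)).
  { rewrite hgen. intros (k & hk).
    assert (h : (IZR (2 * k) = 1)%R) by (rewrite mult_IZR; nra).
    apply eq_IZR in h. lia. }
  assert (hperiod : forall k : nat, Gamma (RtoC (2 * INR k * omega1)) /\
    forall z, ~ Gamma z ->
      zeta (z + RtoC (2 * INR k * omega1)) = zeta z + RtoC (INR k) * (2 * eta1)).
  { induction k as [|k [IH1 IH2]].
    - simpl INR. replace (2 * 0 * omega1)%R with 0%R by ring.
      split; [now apply lattice_0|]. intros z _. rewrite Cplus_0_r. ring.
    - replace (RtoC (2 * INR (S k) * omega1))
        with (RtoC (2 * INR k * omega1) + 2 * RtoC omega1)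
        by (rewrite S_INR, !RtoC_mult, !RtoC_plus; ring).
      split; [now apply lattice_plus|]. intros z hz.
      rewrite Cplus_assoc, (zeta_half_period g2 g3 Gamma wp zeta hwp hzeta) by
        (auto; rewrite lattice_shift; auto).
      rewrite IH2, S_INR, RtoC_plus, heta1 by auto. ring. }
  assert (hiff : forall k : nat, has_period gamma_E (2 * INR k * omega1)%R <->
    exists m : Z, RtoC (INR k) * a = RtoC (IZR m) * RtoC PI * Ci).
  { intros k. destruct (hperiod k) as [h1 h2].
    rewrite (has_period_iff g2 g3 Gamma wp zeta sigma hwp hsigma rho x0 gamma_E _ _ hgamma h1 h2).
    replace (RtoC (INR k) * (2 * eta1) * rho - zeta rho * RtoC (2 * INR k * omega1))
      with (RtoC (INR k) * a) by (unfold a; rewrite !RtoC_mult; ring).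
    reflexivity. }
  assert (hINR : forall k : nat, (1 <= k)%nat -> RtoC (INR k) <> 0).
  { intros k hk. apply RtoC_neq_0. apply not_0_INR. lia. }
  assert (hinj : forall p q : Z, RtoC (IZR p) * RtoC PI * Ci = RtoC (IZR q) * RtoC PI * Ci ->
    p = q).
  { intros p q h. apply (f_equal Im) in h. unfold Im in h; simpl in h.
    pose proof PI_RGT_0. apply eq_IZR. nra. }
  unfold closes_after. setoid_rewrite hiff. split.
  - intros (_ & (m & hm) & hmin). exists m. split.
    (* Dividing n a = m pi i by g = gcd (m, n) shows that n' = n / g periods already close the
       curve; minimality gives n <= n', hence g = 1. *)
    + pose proof (Z.gcd_nonneg m (Z.of_nat n)) as hg.
      destruct (Z.gcd_divide_l m (Z.of_nat n)) as (m' & hm').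
      destruct (Z.gcd_divide_r m (Z.of_nat n)) as (n' & hn').
      set (g := Z.gcd m (Z.of_nat n)) in *.
      clearbody g. assert (hn1 : (0 < Z.of_nat n)%Z) by lia.
      assert (hgp : (0 < g)%Z) by (assert (g <> 0)%Z by (intros ->; lia); lia).
      assert (hn0 : (0 < n')%Z) by nia.
      assert (hle : (n <= Z.to_nat n')%nat); [|nia].
      apply hmin; [lia|]. exists m'.
      assert (hgz : RtoC (IZR g) <> 0) by (apply RtoC_neq_0; apply not_0_IZR; lia).
      assert (h1 : RtoC (INR n) = RtoC (INR (Z.to_nat n')) * RtoC (IZR g)).
      { rewrite <- RtoC_mult. f_equal. rewrite !INR_IZR_INZ, <- mult_IZR. f_equal. lia. }
      rewrite h1, hm', mult_IZR, RtoC_mult in hm.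
      replace (RtoC (INR (Z.to_nat n')) * a)
        with (RtoC (INR (Z.to_nat n')) * RtoC (IZR g) * a / RtoC (IZR g)) by (field; auto).
      rewrite hm. field; auto.
    + rewrite RtoC_div by (apply not_0_INR; lia).
      replace a with (RtoC (INR n) * a / RtoC (INR n)) by (field; auto).
      rewrite hm. field; auto.
  - intros (m & hgcd & ha). rewrite RtoC_div in ha by (apply not_0_INR; lia).
    split; [exact hn|]. split.
    + exists m. rewrite ha. field; auto.
    + intros k hk (m' & hm'). rewrite ha in hm'.
      (* Thus n divides k m, and being prime to m it divides k, so n <= k. *)
      assert (h : (Z.of_nat k * m = m' * Z.of_nat n)%Z).
      { apply hinj. rewrite !mult_IZR, !RtoC_mult, <- !INR_IZR_INZ.
        replace (RtoC (IZR m') * RtoC (INR n) * RtoC PI * Ci)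
          with (RtoC (INR n) * (RtoC (IZR m') * RtoC PI * Ci)) by ring.
        rewrite <- hm'. field; auto. }
      assert (hd : (Z.of_nat n | Z.of_nat k)%Z).
      { apply (Z.gauss _ m); [exists m'; lia | rewrite Z.gcd_comm; exact hgcd]. }
      apply Z.divide_pos_le in hd; lia.
Qed.
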